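(* Let $\delta>0$ and fix $\rho^*\in\mathcal{P}^\delta_{2,c}$. Let $A(\rho^* )=\{\rho\in\mathcal{P}^\delta_{2,c}:{\mathbb{D}}^\delta(\rho,\rho^* )<\infty\}$. Then ${\mathbb{D}}^\delta$ restricted to $A(\rho^* )\times A(\rho^* )$ is a (finite) metric, and for any $\rho^0,\rho^1\in A(\rho^* )$ there exists $(\rho,\mathfrak{w})\in\mathcal{C}(\rho^0,\rho^1)$ with $\mathfrak{A}^\delta(\rho,\mathfrak{w})={\mathbb{D}}^\delta(\rho^0,\rho^1)^2$.
   Context: Fix $\delta>0$. For $f:\mathbb{Z}\to\mathbb{R}$ let $(\Delta^{\!\delta} f)_\kappa=(f_{\kappa+1}+f_{\kappa-1}-2f_\kappa)/\delta^2$. Let $\mathcal{P}^\delta_{2,c}$ be the set of $\rho:\mathbb{Z}\to[0,\infty)$ with $\delta\sum_\kappa\rho_\kappa=1$, $\delta\sum_\kappa(\delta\kappa)^2\rho_\kappa<\infty$ and $\delta\sum_\kappa(\delta\kappa)\rho_\kappa=0$. Define $Q(p,r)=p^2/r$ if $r>0$, $Q(0,0)=0$, $Q(p,0)=+\infty$ if $p\neq0$. The class $\mathcal{C}$ consists of pairs $(\rho,\mathfrak{w})$ of maps $\rho:[0,1]\to\mathcal{P}^\delta_{2,c}$, $\mathfrak{w}:[0,1]\to\ell^2$ such that for every $\kappa$, $\rho_\kappa\in H^1(0,1)$ (continuous representative), $\mathfrak{w}_\kappa\in L^2(0,1)$, and $\dot\rho_\kappa(s)=(\Delta^{\!\delta}\mathfrak{w}(s))_\kappa$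 for a.e. $s$; $\mathcal{C}(\rho^0,\rho^1)$ is the subset with $\rho(0)=\rho^0$, $\rho(1)=\rho^1$. The action is $\mathfrak{A}^\delta(\rho,\mathfrak{w})=\delta\sum_\kappa\int_0^1Q(\mathfrak{w}_\kappa(s),\rho_\kappa(s))\,ds$, and the discrete diffusive transport distance is ${\mathbb{D}}^\delta(\rho^0,\rho^1)^2=\inf\{\mathfrak{A}^\delta(\rho,\mathfrak{w}):(\rho,\mathfrak{w})\in\mathcal{C}(\rho^0,\rho^1)\}\in[0,\infty]$. *)

(* Defs.v *)
From HB Require Import structures.
From mathcomp Require Import all_boot all_order all_algebra.
From mathcomp Require Import all_classical all_reals all_analysis.
Set Implicit Arguments. Unset Strict Implicit. Unset Printing Implicit Defensive.
Import Order.TTheory GRing.Theory Num.Theory.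
Import numFieldNormedType.Exports.
Local Open Scope classical_set_scope.
Local Open Scope ring_scope.

Section DDT.
Variable R : realType.

Definition dlap (delta : R) (f : int -> R) (k : int) : R :=
  (f (k + 1)%R + f (k - 1)%R - 2 * f k) / delta ^+ 2.

Definition P2c (delta : R) (rho : int -> R) : Prop :=
  (forall k, 0 <= rho k) /\
  (delta%:E * (\esum_(k in [set: int]) (rho k)%:E) = 1)%E /\
  (delta%:E * (\esum_(k in [set: int]) ((delta * k%:~R) ^+ 2 * rho k)%:E) < +oo)%E /\
  (* centered: delta * sum_k (delta k) rho_k = 0, the series being absolutely
     convergent; written as equality of positive and negative parts *)
  (delta%:E * (\esum_(k in [set k : int | (0 < k)%R]) ((delta * k%:~R) * rho k)%:E) =
   delta%:E * \esum_(k in [set k : int | (k < 0)%R]) (- (delta * k%:~R) * rho k)%:E)%E.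

Definition Qf (p r : R) : \bar R :=
  if 0 < r then (p ^+ 2 / r)%:E else if p == 0 then 0%E else +oo%E.

(* (rho, w) in C(rho0, rho1); paths are indexed by s in [0,1] (values outside
   [0,1] are irrelevant). *)
Definition inC (delta : R) (rho0 rho1 : int -> R)
    (rho : R -> int -> R) (w : R -> int -> R) : Prop :=
  (forall s, s \in `[(0%R:R), 1%R] -> P2c delta (rho s)) /\
  (forall s, s \in `[(0%R:R), 1%R] ->
     ((\esum_(k in [set: int]) ((w s k) ^+ 2)%:E) < +oo)%E) /\
  (forall k : int,
     (* rho_k in H^1(0,1), continuous representative, with derivative
        (Delta w)_k a.e.; w_k in L^2(0,1) *)
     {within `[(0%R:R), 1%R], continuous (fun s => rho s k)} /\
     measurable_fun `[(0%R:R), 1%R] (fun s => w s k) /\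
     ((\int[lebesgue_measure]_(s in `[(0%R:R), 1%R]) ((w s k) ^+ 2)%:E) < +oo)%E /\
     (forall t, t \in `[(0%R:R), 1%R] ->
        ((rho t k - rho 0 k)%:E =
         \int[lebesgue_measure]_(s in `[(0%R:R), t]) (dlap delta (w s) k)%:E)%E)) /\
  rho 0 = rho0 /\ rho 1 = rho1.

Definition action (delta : R) (rho : R -> int -> R) (w : R -> int -> R) : \bar R :=
  (delta%:E * \esum_(k in [set: int])
     \int[lebesgue_measure]_(s in `[(0%R:R), 1%R]) Qf (w s k) (rho s k))%E.

Definition Dsq (delta : R) (rho0 rho1 : int -> R) : \bar R :=
  ereal_inf [set a | exists rho w, inC delta rho0 rho1 rho w /\ a = action delta rho w].

(* D^delta itself, as a real number (meaningful when Dsq is finite) *)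
Definition Dist (delta : R) (rho0 rho1 : int -> R) : R :=
  Num.sqrt (fine (Dsq delta rho0 rho1)).

End DDT.

(* Main.v *)
Require Import Defs.
From HB Require Import structures.
From mathcomp Require Import all_boot all_order all_algebra.
From mathcomp Require Import all_classical all_reals all_analysis.
From mathcomp Require Import measurable_realfun.
From mathcomp Require Import ring lra zify.
Import Order.TTheory GRing.Theory Num.Theory.
Import numFieldNormedType.Exports.
Set Implicit Arguments.
Unset Strict Implicit.
Unset Printing Implicit Defensive.
Local Open Scope classical_set_scope.
Local Open Scope ring_scope.

(** Existence of minimizers needs no weak compactness.  The action is jointly
    convex and controls the energy [G w = sum_k int w_k^2], so one may choose a
    minimizing sequence whose members nearly minimize [G] on shrinking sublevel
    sets of the action; by the parallelogram identity the [w_k] are then Cauchy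
    in [L^2].  Along this fast Cauchy sequence the [w_k] converge almost
    everywhere and dominatedly, the continuity equation passes to the limit,
    and Fatou's lemma bounds the action.  Mass and centering of the limit are
    preserved, and its second moment stays finite, because
    [2 |w| <= Q (w, rho) + rho] makes [int w_k] summable in [k] and the
    increments of [rho] are discrete Laplacians, which can be tested against
    compactly supported functions with bounded Laplacian.  Definiteness follows
    from a minimizer of zero action, symmetry from time reversal, and the
    triangle inequality from concatenation at time [a / (a + b)]. *)

(** * Affine change of variables *)

(** [Q] is homogeneous of degree one in the pair, hence not strictly convex, and nearly minimal
    action alone does not make a sequence Cauchy; the quadratic energy [G] supplies the uniform
    convexity. It is controlled because the mass constraint forces [rho s k <= delta^-1], so that
    [w^2 <= delta^-1 Q]. The other obstacle is that [P2c] is not closed under pointwise limits: mass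
    can escape to infinity, and limits of sums give only inequalities. Hence the admissibility
    criterion [inC_of_finite_action] asks [P2c] of the starting point alone, and otherwise
    nonnegativity, an upper bound on the mass, continuity, measurability, finite action and the
    continuity equation; it serves the limit path, time reversal and concatenation alike. *)

Section affine_change_of_variables.
Context {R : realType}.
Local Notation mu := (@lebesgue_measure R).
Implicit Types (a b : R) (D : set R).

Definition affine (a b : R) (x : measurableTypeR R) : measurableTypeR R := a * x + b.

Lemma measurable_affine a b : measurable_fun setT (affine a b).
Proof.
by apply: continuous_measurable_fun => x; apply: cvgD; [exact: cvgMr|exact: cvg_cst].
Qed.

Lemma affine_preimage_oc a b c d : 0 < a ->
  affine a b @^-1` `]c, d]%classic = `](c - b) / a, (d - b) / a]%classic.
Proof.
move=> a0; apply/seteqP; split => x /=; rewrite !in_itv/= /affine.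
  by rewrite ltr_pdivrMr// ler_pdivlMr// => /andP[h1 h2]; apply/andP; split; lra.
by rewrite ltr_pdivrMr// ler_pdivlMr// => /andP[h1 h2]; apply/andP; split; lra.
Qed.

Lemma affine_preimage_co a b c d : a < 0 ->
  affine a b @^-1` `]c, d]%classic = `[(d - b) / a, (c - b) / a[%classic.
Proof.
move=> a0; apply/seteqP; split => x /=; rewrite !in_itv/= /affine.
  by rewrite ltr_ndivlMr// ler_ndivrMr// => /andP[h1 h2]; apply/andP; split; lra.
by rewrite ltr_ndivlMr// ler_ndivrMr// => /andP[h1 h2]; apply/andP; split; lra.
Qed.

(** The pushforward of Lebesgue measure, scaled by [|a|], gives half-open intervals their length, so
    uniqueness of Lebesgue measure identifies the two. A negative slope only moves the closed end of
    the interval. *)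
Lemma lebesgue_measure_affine a b D : a != 0 -> measurable D ->
  mu D = (`|a|%:E * mu (affine a b @^-1` D))%E.
Proof.
move=> a0 mD.
have ma := measurable_affine a b.
pose phi : {mfun measurableTypeR R >-> measurableTypeR R} := mfun_Sub (mem_set ma).
pose k : {nonneg R} := NngNum (normr_ge0 a).
have -> : (`|a|%:E * mu (affine a b @^-1` D))%E = mscale k (pushforward mu phi) D by [].
apply: (@lebesgue_measure_unique _ (mscale k (pushforward mu phi))) => //.
move=> _ [[c d] _ <-].
transitivity (`|a|%:E * mu (affine a b @^-1` `]c, d]%classic))%E; last by [].
have := a0; rewrite neq_lt => /orP[an|ap].
- rewrite affine_preimage_co// !lebesgue_measure_itv/= !lte_fin.
  rewrite ltr_nM2r ?invr_lt0// ltrD2r; case: ifPn => cd; last by rewrite mule0.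
  rewrite -!EFinB -EFinM ltr0_norm//; congr (_%:E).
  by field; rewrite lt_eqF.
- rewrite affine_preimage_oc// !lebesgue_measure_itv/= !lte_fin.
  rewrite ltr_pM2r ?invr_gt0// ltrD2r; case: ifPn => cd; last by rewrite mule0.
  rewrite -!EFinB -EFinM gtr0_norm//; congr (_%:E).
  by field; rewrite gt_eqF.
Qed.

Lemma ge0_integral_affine a b D (f : R -> \bar R) : a != 0 ->
  measurable D -> measurable_fun D f -> (forall x, D x -> 0 <= f x)%E ->
  (\int[mu]_(x in D) f x =
   `|a|%:E * \int[mu]_(x in affine a b @^-1` D) f (affine a b x))%E.
Proof.
move=> a0 mD mf f0.
have ma := measurable_affine a b.
pose phi : {mfun measurableTypeR R >-> measurableTypeR R} := mfun_Sub (mem_set ma).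
pose k : {nonneg R} := NngNum (normr_ge0 a).
have := @ge0_integral_pushforward _ _ _ _ R phi ma mu D f mD mf.
move=> /(_ (fun y yD => f0 y (set_mem yD))) => <-.
rewrite -(ge0_integral_mscale (pushforward mu phi) mD k mf f0).
apply: eq_measure_integral => A mA AD.
exact: lebesgue_measure_affine.
Qed.

Lemma measurable_fun_affine d (T : measurableType d) a b D (f : R -> T) :
  measurable D -> measurable_fun D f ->
  measurable_fun (affine a b @^-1` D) (f \o affine a b).
Proof.
move=> mD mf; apply: (measurable_comp mD _ mf).
- by move=> _ [x + <-].
- exact: measurable_funS (measurable_affine a b).
Qed.

Lemma measurable_affine_preimage a b D : measurable D -> measurable (affine a b @^-1` D).
Proof.
by move=> mD; rewrite -[X in measurable X]setTI; exact: measurable_affine.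
Qed.

Lemma integral_affine a b D (f : R -> \bar R) : a != 0 ->
  measurable D -> mu.-integrable D f ->
  mu.-integrable (affine a b @^-1` D) (f \o affine a b) /\
  (\int[mu]_(x in D) f x =
   `|a|%:E * \int[mu]_(x in affine a b @^-1` D) f (affine a b x))%E.
Proof.
move=> a0 mD /integrableP[mf If].
have mf' := @measurable_fun_affine _ _ a b D f mD mf.
have If' : mu.-integrable (affine a b @^-1` D) (f \o affine a b).
  apply/integrableP; split => //.
  (* An infinite integral of the composite, multiplied by [|a| > 0], would make the integral of
     [|f|] infinite too. *)
  rewrite ltNge leye_eq; apply/eqP => E; move: If.
  rewrite (@ge0_integral_affine a b D (fun x => `|f x|)%E)//; last exact: measurableT_comp.
  by rewrite E gt0_muley ?ltxx// lte_fin normr_gt0.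
split => //.
have Ep : (\int[mu]_(x in affine a b @^-1` D) (f \o affine a b)^\+ x =
    \int[mu]_(x in affine a b @^-1` D) (f^\+) (affine a b x))%E.
  by apply: eq_integral => x _; rewrite funepos_comp.
have En : (\int[mu]_(x in affine a b @^-1` D) (f \o affine a b)^\- x =
    \int[mu]_(x in affine a b @^-1` D) (f^\-) (affine a b x))%E.
  by apply: eq_integral => x _; rewrite funeneg_comp.
transitivity (`|a|%:E * (\int[mu]_(x in affine a b @^-1` D) (f \o affine a b)^\+ x -
   \int[mu]_(x in affine a b @^-1` D) (f \o affine a b)^\- x))%E; last by rewrite -integralE.
rewrite muleBr//; last exact: (integrable_add_def (@measurable_affine_preimage a b D mD) If').
rewrite integralE Ep En; congr (_ - _)%E.
  by apply: ge0_integral_affine => //; exact: measurable_funepos.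
by apply: ge0_integral_affine => //; exact: measurable_funeneg.
Qed.

End affine_change_of_variables.

(** * Sums over the integers and inferior limits *)

Section esum_complements.
Context {R : realType} {T : choiceType}.
Implicit Types (I : set T) (a b : T -> \bar R).
Local Open Scope ereal_scope.

Lemma esum_le_bound I a x :
  (forall s : seq T, uniq s -> (forall i, i \in s -> I i) ->
    \sum_(i <- s) a i <= x) -> \esum_(i in I) a i <= x.
Proof.
move=> h; apply: ge_ereal_sup => _ [X [fX XI] <-].
rewrite fsbig_finite//; apply: h => // i.
by rewrite in_fset_set// => /set_mem; exact: XI.
Qed.

Lemma sum_le_esum I a (s : seq T) : uniq s -> (forall i, i \in s -> I i) ->
  \sum_(i <- s) a i <= \esum_(i in I) a i.
Proof.
move=> us sI; apply: esum_ge; exists [set` s]; first by split.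
rewrite fsbig_finite//= le_eqVlt; apply/orP; left; apply/eqP.
apply: perm_big; apply: uniq_perm => //.
by move=> i; rewrite in_fset_set// mem_setE.
Qed.

Lemma term_le_esum I a i : I i -> a i <= \esum_(j in I) a j.
Proof.
move=> Ii; have := @sum_le_esum I a [:: i]; rewrite big_seq1; apply => //.
by move=> j; rewrite inE => /eqP ->.
Qed.

(** One inequality valid for every positive factor suffices: used with [c^-1] on the scaled family,
    it is the reverse one. *)
Lemma esumZl I a (c : R) : (0 <= c)%R -> (forall i, I i -> 0 <= a i) ->
  \esum_(i in I) (c%:E * a i) = c%:E * \esum_(i in I) a i.
Proof.
rewrite le_eqVlt => /predU1P[<- a0|c0 a0].
  by rewrite mul0e esum1// => i _; rewrite mul0e.
have H (b : T -> \bar R) (d : R) : (0 < d)%R -> (forall i, I i -> 0 <= b i) ->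
    \esum_(i in I) (d%:E * b i) <= d%:E * \esum_(i in I) b i.
  move=> d0 b0; apply: esum_le_bound => s us sI.
  rewrite big_seq -ge0_sume_distrr; last by move=> i /sI; exact: b0.
  by rewrite -big_seq lee_pmul2l//; exact: sum_le_esum.
apply/eqP; rewrite eq_le H//=.
have := H (fun i => c%:E * a i) c^-1%R.
rewrite invr_gt0 => /(_ c0); under eq_esum do rewrite muleA -EFinM mulVf ?gt_eqF// mul1e.
move=> h; have : \esum_(i in I) a i <= c^-1%:E * \esum_(i in I) (c%:E * a i).
  by apply: h => i Ii; rewrite mule_ge0 ?a0// lee_fin ltW.
by rewrite lee_pdivlMl.
Qed.

End esum_complements.

(** Turns unordered sums over the integers into series over [nat], where monotone convergence and
    countable intersections of full-measure sets apply. *)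
Definition int_enum (n : nat) : int := if odd n then Negz n./2 else Posz n./2.

Lemma int_enum_bij : set_bij [set: nat] [set: int] int_enum.
Proof.
split => //.
- move=> m n _ _; rewrite /int_enum.
  have := odd_double_half m; have := odd_double_half n.
  by case: (odd m); case: (odd n) => // hn hm [e]; rewrite -hm -hn e.
- move=> [n|n] _; [exists n.*2 => //|exists n.*2.+1 => //].
    by rewrite /int_enum odd_double doubleK.
  by rewrite /int_enum/= odd_double/= uphalf_double.
Qed.

Lemma esum_int_nneseries (R : realType) (a : int -> \bar R) :
  (forall k, 0 <= a k)%E ->
  (\esum_(k in [set: int]) a k = \sum_(n <oo) a (int_enum n))%E.
Proof.
move=> a0; rewrite (reindex_esum _ _ _ _ int_enum_bij) nneseries_esumT//.
Qed.

Section integral_esum.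
Context d (T : measurableType d) (R : realType) (mu : {measure set T -> \bar R}).
Variables (D : set T) (mD : measurable D) (f : int -> T -> \bar R).
Hypothesis mf : forall k, measurable_fun D (f k).
Hypothesis f0 : forall k x, D x -> (0 <= f k x)%E.

Lemma measurable_fun_esum_int :
  measurable_fun D (fun x => \esum_(k in [set: int]) f k x)%E.
Proof.
apply: (eq_measurable_fun (fun x => \sum_(n <oo) f (int_enum n) x)%E).
  by move=> x /set_mem Dx; rewrite esum_int_nneseries// => k; exact: f0.
by apply: ge0_emeasurable_sum => // n x Dx _; exact: f0.
Qed.

Lemma integral_esum_int :
  (\int[mu]_(x in D) (\esum_(k in [set: int]) f k x) =
   \esum_(k in [set: int]) \int[mu]_(x in D) f k x)%E.
Proof.
rewrite esum_int_nneseries; last by move=> k; apply: integral_ge0 => x; exact: f0.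
rewrite -integral_nneseries//; last by move=> n x; exact: f0.
apply: eq_integral => x /set_mem Dx.
by rewrite esum_int_nneseries// => k; exact: f0.
Qed.

End integral_esum.

Section limn_einf_complements.
Context {R : realType}.
Implicit Types u v : (\bar R)^nat.
Local Open Scope ereal_scope.

Lemma le_limn_einf u v : (forall n, u n <= v n) -> limn_einf u <= limn_einf v.
Proof.
move=> uv; rewrite !limn_einf_lim; apply: lee_lim; [exact: is_cvg_einfs..|].
apply: nearW => n; apply: le_ereal_inf_tmp => _ [k /= nk <-].
by apply: le_trans (uv k); apply: ereal_inf_lbound; exists k.
Qed.

Lemma cvg_le_limn_einf u v l : u @ \oo --> l -> (forall n, u n <= v n) ->
  l <= limn_einf v.
Proof. by move=> /cvg_limn_einf_sup[<- _]; exact: le_limn_einf. Qed.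

Lemma limn_einf_le_cvg u v l : v @ \oo --> l -> (forall n, u n <= v n) ->
  limn_einf u <= l.
Proof. by move=> /cvg_limn_einf_sup[<- _]; exact: le_limn_einf. Qed.

Lemma limn_einf_ge0 u : (forall n, 0 <= u n) -> 0 <= limn_einf u.
Proof. by move=> u0; apply: cvg_le_limn_einf u0; exact: cvg_cst. Qed.

(** The inequality holds for the infima of tails and passes to their limits; nonnegativity keeps the
    sum of the limits defined. *)
Lemma limn_einfD_ge u v : (forall n, 0 <= u n) -> (forall n, 0 <= v n) ->
  limn_einf u + limn_einf v <= limn_einf (fun n => u n + v n).
Proof.
move=> u0 v0.
have einf0 w n : (forall n, 0 <= w n) -> 0 <= einfs w n.
  by move=> w0; apply: le_ereal_inf_tmp => _ [k _ <-].
rewrite !limn_einf_lim -limeD; [|exact: is_cvg_einfs..|]; last first.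
  by apply: ge0_adde_def; rewrite inE; apply: lime_ge;
    [exact: is_cvg_einfs|apply: nearW => n; exact: einf0
    |exact: is_cvg_einfs|apply: nearW => n; exact: einf0].
apply: lee_lim.
- apply: is_cvgeD; [|exact: is_cvg_einfs..].
  by apply: ge0_adde_def; rewrite inE; apply: lime_ge;
    [exact: is_cvg_einfs|apply: nearW => n; exact: einf0
    |exact: is_cvg_einfs|apply: nearW => n; exact: einf0].
- exact: is_cvg_einfs.
- apply: nearW => n; apply: le_ereal_inf_tmp => _ [k /= nk <-].
  by apply: leeD; apply: ereal_inf_lbound; exists k.
Qed.

Lemma limn_einf_sum_ge (I : Type) (s : seq I) (u : I -> (\bar R)^nat) :
  (forall i n, 0 <= u i n) ->
  \sum_(i <- s) limn_einf (u i) <= limn_einf (fun n => \sum_(i <- s) u i n).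
Proof.
move=> u0; elim: s => [|i s ih].
  by rewrite big_nil; apply: limn_einf_ge0 => n; rewrite big_nil.
rewrite big_cons; under [X in _ <= limn_einf X]funext do rewrite big_cons.
apply: le_trans (limn_einfD_ge _ _) => //; first by rewrite leeD2l.
by move=> n; apply: sume_ge0.
Qed.

End limn_einf_complements.

(** * The function [Q] *)

Section Qf_theory.
Context {R : realType}.
Implicit Types p r c : R.

Lemma Qf_ge0 p r : (0 <= Qf p r)%E.
Proof.
rewrite /Qf; case: ifPn => [r0|_]; last by case: ifPn.
by rewrite lee_fin divr_ge0 ?sqr_ge0// ltW.
Qed.

Lemma Qf0 r : Qf 0 r = 0%E.
Proof. by rewrite /Qf eqxx expr0n/= mul0r; case: ifP. Qed.

(** For [r > 0] the difference is [(p - c r)^2 / r]. Equality at [c = p / r] makes these affine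
    functions the tangent planes of [Q]. *)
Lemma Qf_affine_le p r c : 0 <= r -> ((2 * c * p - c ^+ 2 * r)%:E <= Qf p r)%E.
Proof.
rewrite le_eqVlt => /predU1P[<-|r0]; rewrite /Qf.
  rewrite ltxx; case: ifPn => [/eqP ->|_]; last exact: leey.
  by rewrite !mulr0 subrr.
rewrite r0 lee_fin ler_pdivlMr// -subr_ge0.
rewrite [leRHS](_ : _ = (p - c * r) ^+ 2) ?sqr_ge0//; ring.
Qed.

(* [Q] is the supremum of the affine functions [2 c p - c^2 r]; convexity and
   lower semicontinuity both follow. *)
Lemma Qf_le_of_affine p r (y : \bar R) : 0 <= r ->
  (forall c, ((2 * c * p - c ^+ 2 * r)%:E <= y)%E) -> (Qf p r <= y)%E.
Proof.
rewrite le_eqVlt => /predU1P[<-|r0] h; rewrite /Qf.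
  rewrite ltxx; case: ifPn => [_|p0]; first by have := h 0; rewrite !(mulr0, mul0r, subrr).
  (* At [r = 0] and [p <> 0] the bounds are [2 c p]; the slope [c = z / (2 p)] makes them reach any
     real [z]. *)
  rewrite leye_eq; apply/eqP/eq_infty => z.
  apply: le_trans (h (z / (2 * p))); rewrite mulr0 subr0 lee_fin.
  by rewrite le_eqVlt; apply/orP; left; apply/eqP; field.
rewrite r0; apply: le_trans (h (p / r)); rewrite lee_fin.
by rewrite le_eqVlt; apply/orP; left; apply/eqP; field; rewrite gt_eqF.
Qed.

Lemma Qf_scale p r c : (Qf (c * p) r = (c ^+ 2)%:E * Qf p r)%E.
Proof.
rewrite /Qf; have [r0|r0] := boolP (0 < r); first by rewrite -EFinM; congr (_%:E); ring.
have [->|c0] := eqVneq c 0; first by rewrite mul0r eqxx expr0n mul0e.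
rewrite mulf_eq0 (negbTE c0)/=; case: ifPn => _; first by rewrite mule0.
by rewrite gt0_muley// lte_fin exprn_even_gt0.
Qed.

Lemma Qf_midpoint_le p1 p2 r1 r2 : 0 <= r1 -> 0 <= r2 ->
  (Qf ((p1 + p2) / 2) ((r1 + r2) / 2) <= 2^-1%:E * (Qf p1 r1 + Qf p2 r2))%E.
Proof.
move=> r10 r20; apply: Qf_le_of_affine => [|c]; first by rewrite divr_ge0// addr_ge0.
apply: (@le_trans _ _ (2^-1%:E *
    ((2 * c * p1 - c ^+ 2 * r1)%:E + (2 * c * p2 - c ^+ 2 * r2)%:E))%E).
  by rewrite -EFinD -EFinM lee_fin; lra.
by rewrite lee_pmul2l// leeD//; exact: Qf_affine_le.
Qed.

(** Where [Q] is finite, [p^2 = r Q(p, r)]. *)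
Lemma sqr_le_Qf p r (M : R) : 0 < M -> 0 <= r -> r <= M ->
  ((p ^+ 2)%:E <= M%:E * Qf p r)%E.
Proof.
move=> M0; rewrite le_eqVlt => /predU1P[<- _|r0 rM]; rewrite /Qf.
  rewrite ltxx; case: ifPn => [/eqP->|_]; first by rewrite expr0n mule0.
  by rewrite gt0_muley// leey.
rewrite r0 -EFinM lee_fin mulrCA ler_peMr ?sqr_ge0// ler_pdivlMr// mul1r//.
Qed.

Lemma norm_le_Qf p r : 0 <= r -> ((2 * `|p|)%:E <= Qf p r + r%:E)%E.
Proof.
move=> r0; rewrite -leeBlDr//.
case: (ger0P p) => p0.
  (* The slope [1] or [-1], according to the sign of [p], turns [2 c p - c^2 r] into [2 |p| - r]. *)
  apply: le_trans (Qf_affine_le _ 1 r0); rewrite -EFinB lee_fin; lra.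
apply: le_trans (Qf_affine_le _ (-1) r0); rewrite -EFinB lee_fin; lra.
Qed.

Lemma Qf_le_limn_einf (p r : R^nat) (p0 r0 : R) : (forall n, 0 <= r n) ->
  p @ \oo --> p0 -> r @ \oo --> r0 ->
  (Qf p0 r0 <= limn_einf (fun n => Qf (p n) (r n)))%E.
Proof.
move=> rge0 cp cr; apply: Qf_le_of_affine => [|c].
  by rewrite -(cvg_lim _ cr)//; apply: limr_ge; [apply: cvgP cr|apply: nearW].
apply: (cvg_le_limn_einf (u := fun n => (2 * c * p n - c ^+ 2 * r n)%:E)) => [|n].
  apply: cvg_EFin; first exact: nearW.
  by apply: cvgB; apply: cvgMr.
exact: Qf_affine_le.
Qed.

Lemma measurable_fun_Qf d (T : measurableType d) (D : set T) (f g : T -> R) :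
  measurable D -> measurable_fun D f -> measurable_fun D g ->
  measurable_fun D (fun x => Qf (f x) (g x)).
Proof.
move=> mD mf mg; rewrite /Qf.
apply: measurable_fun_if => //.
- exact: measurable_fun_ltr.
- apply/measurable_EFinP/measurable_funM.
    by apply: measurable_funX; apply: measurable_funS mf => //; exact: subIsetl.
  (* Where [g] is positive, its inverse is a real power, and real powers are measurable. *)
  apply: (eq_measurable_fun (fun x => powR (g x) (-1))).
    by move=> x /set_mem[_ gx]; rewrite powR_inv1// ltW.
  apply: (measurableT_comp (measurable_powR (-1))).
  by apply: measurable_funS mg => //; exact: subIsetl.
- have m0 : measurable (D `&` (fun x => 0 < g x) @^-1` [set false]).
    by apply: measurable_fun_ltr => //; exact: measurable_cst.
  apply: measurable_fun_if => //.
  apply: measurable_fun_eqr => //.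
  by apply: measurable_funS mf => //; exact: subIsetl.
Qed.

End Qf_theory.

(** * Conservation of moments *)

Definition zrange (N : nat) : seq int := [seq i%:Z - N%:Z | i <- iota 0 N.*2.+1].

Lemma mem_zrange N k : (k \in zrange N) = (`|k|%N <= N)%N.
Proof.
apply/mapP/idP => [[i]|kN].
  by rewrite mem_iota => /andP[_ iN] ->; lia.
exists (`|(k + N%:Z)%R|%N); last by lia.
by rewrite mem_iota; apply/andP; split; lia.
Qed.

Lemma zrange_uniq N : uniq (zrange N).
Proof. by rewrite map_inj_uniq ?iota_uniq// => i j; lia. Qed.

Lemma sub_zrange (s : seq int) : exists N, forall k, k \in s -> (`|k|%N <= N)%N.
Proof.
exists (\max_(k <- s) `|k|%N) => k ks.
exact: (@leq_bigmax_seq _ _ predT (fun k : int => `|k|%N)).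
Qed.

Lemma zrange_telescope (V : zmodType) (F : int -> V) N :
  \sum_(k <- zrange N) (F (k + 1) - F k) = F (N%:Z + 1) - F (- N%:Z).
Proof.
rewrite big_map -[N.*2.+1]subn0 -/(index_iota _ _).
have := @telescope_sumr _ 0 N.*2.+1 (fun i : nat => F (i%:Z - N%:Z)).
move=> /(_ isT) /=; rewrite sub0r => h.
rewrite (_ : N%:Z + 1 = (N.*2.+1)%:Z - N%:Z) -?h; last by lia.
by apply: eq_bigr => i _; congr (F _ - _); lia.
Qed.

(** Generic in the codomain, so that second differences of integer-valued test functions can be
    computed in [int], by linear integer arithmetic or [ring], before the cast to [R]. *)
Definition lapl {V : zmodType} (f : int -> V) (k : int) : V :=
  f (k + 1) + f (k - 1) - f k *+ 2.

Lemma ler_sum_subseq (R : numDomainType) (I : eqType) (s t : seq I) (f : I -> R) :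
  uniq s -> uniq t -> {subset s <= t} -> (forall i, 0 <= f i) ->
  \sum_(i <- s) f i <= \sum_(i <- t) f i.
Proof.
move=> us ut st f0; rewrite [leRHS](bigID (mem s))/=.
have -> : \sum_(i <- t | i \in s) f i = \sum_(i <- s) f i.
  rewrite -big_filter; apply: perm_big; apply: uniq_perm => //.
    exact: filter_uniq.
  by move=> i; rewrite mem_filter; apply/andP/idP => [[]//|si]; split => //; exact: st.
by rewrite lerDl sumr_ge0.
Qed.

(** * Summation by parts against truncated weights *)

Section summation_by_parts.
Context {R : realType}.
Implicit Types (a b f eta W : int -> R).

(** Discrete Green identity: the difference of the summands is the increment of the Wronskian [G],
    so the sum telescopes. Both boundary terms involve [eta] only at points with [M <= |k|], where
    it vanishes. *)
Lemma lapl_sum_by_parts eta W (M : nat) :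
  (forall k, (M <= `|k|)%N -> eta k = 0) ->
  \sum_(k <- zrange M) eta k * lapl W k = \sum_(k <- zrange M) lapl eta k * W k.
Proof.
move=> eta0; apply/eqP; rewrite -subr_eq0 -sumrB.
pose G k := eta (k - 1) * W k - eta k * W (k - 1).
rewrite (eq_bigr (fun k => G (k + 1) - G k)); last first.
  move=> k _; rewrite /G /lapl (_ : k + 1 - 1 = k); [ring|lia].
rewrite zrange_telescope /G (eta0 (M%:Z + 1)) ?(eta0 (- M%:Z))
  ?(eta0 (M%:Z + 1 - 1)) ?(eta0 (- M%:Z - 1)); try lia.
by rewrite !mul0r !subrr.
Qed.

Lemma esum_int_le_zrange f (x : \bar R) : (forall k, 0 <= f k) ->
  (forall N, (\sum_(k <- zrange N) f k)%:E <= x)%E ->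
  (\esum_(k in [set: int]) (f k)%:E <= x)%E.
Proof.
move=> f0 h; apply: esum_le_bound => s us _.
have [N sN] := sub_zrange s.
apply: le_trans (h N).
rewrite sumEFin lee_fin; apply: ler_sum_subseq => //; first exact: zrange_uniq.
by move=> k ks; rewrite mem_zrange sN.
Qed.

(** A finite set of indices carries the total up to [e]; every finite sum disjoint from it is then
    at most [e]. *)
Lemma esum_tail_small W (e : R) : 0 < e ->
  (\esum_(k in [set: int]) `|W k|%:E < +oo)%E ->
  exists N0, forall N M, (N0 <= N)%N ->
    \sum_(k <- zrange M | (N < `|k|)%N) `|W k| <= e.
Proof.
move=> e0 Wfin; set T := (\esum_(k in _) _)%E in Wfin.
have Tfin : T \is a fin_num.
  by rewrite ge0_fin_numE//; apply: esum_ge0 => k _; rewrite lee_fin.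
have [_ [X [fX _] <-] TX] := ub_ereal_sup_adherent e0 Tfin.
rewrite fsbig_finite// in TX; set s := (X in \sum_(x <- X) _) in TX.
have [N0 sN0] := sub_zrange s.
exists N0 => N M N0N.
set S := \sum_(k <- _ | _) _.
have h : ((S + \sum_(k <- s) `|W k|)%:E <= T)%E.
  rewrite /S -big_filter -big_cat -sumEFin; apply: sum_le_esum => //.
  rewrite cat_uniq filter_uniq ?zrange_uniq// finmap.fset_uniq andbT.
  apply/hasPn => k ks; rewrite mem_filter mem_zrange negb_and -leqNgt.
  by rewrite (leq_trans (sN0 _ ks)).
rewrite -(fineK Tfin) lee_fin in h.
have : (T - e%:E < \sum_(k <- s) `|W k|%:E)%E := TX.
rewrite -(fineK Tfin) sumEFin -EFinB lte_fin; lra.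
Qed.

Section test_functions.
Variables (a b W : int -> R).
Hypotheses (a0 : forall k, 0 <= a k) (b0 : forall k, 0 <= b k).
Hypothesis bW : forall k, b k - a k = lapl W k.
Variables (phi : int -> R) (eta : nat -> int -> R) (M : nat -> nat).
Hypothesis eta_ge0 : forall N k, 0 <= eta N k.
Hypothesis eta_le : forall N k, eta N k <= phi k.
Hypothesis etaE : forall N k, (`|k| <= N)%N -> eta N k = phi k.
Hypothesis eta0 : forall N k, (M N <= `|k|)%N -> eta N k = 0.

(** [phi] is the weight of the moment and [eta N] are its cutoffs. A partial sum of [phi b] is below
    the sum of [eta N b], which by parts is the sum of [eta N a] plus that of [lapl (eta N) W]. *)
Lemma esum_le_of_test_functions (x : R) (N0 : nat) :
  (forall N, (N0 <= N)%N -> \sum_(k <- zrange (M N)) lapl (eta N) k * W k <= x) ->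
  (\esum_(k in [set: int]) (phi k * b k)%:E <=
   \esum_(k in [set: int]) (phi k * a k)%:E + x%:E)%E.
Proof.
move=> hx; have phi0 k : 0 <= phi k by apply: le_trans (eta_le 0 k).
apply: esum_int_le_zrange => [k|N]; first by rewrite mulr_ge0.
(* [N'] is large enough for [hx]; the range up to [M'] contains both [zrange N] and the support of
   [eta N']. *)
pose N' := maxn N N0; pose M' := maxn (M N') N'.
have eM : \sum_(k <- zrange (M N')) eta N' k * b k = \sum_(k <- zrange M') eta N' k * b k.
  rewrite [RHS](bigID (mem (zrange (M N'))))/= [X in _ = _ + X]big1_seq ?addr0; last first.
    by move=> k /andP[+ _]; rewrite mem_zrange -ltnNge => h; rewrite eta0 ?mul0r// ltnW.
  rewrite -[RHS]big_filter; apply: perm_big; apply: uniq_perm.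
  - exact: zrange_uniq.
  - exact/filter_uniq/zrange_uniq.
  - move=> k; rewrite mem_filter !mem_zrange.
    by apply/idP/andP => [h|[]//]; split => //; apply: leq_trans h _; exact: leq_maxl.
apply: (@le_trans _ _ (\sum_(k <- zrange (M N')) eta N' k * b k)%:E).
  rewrite lee_fin eM; apply: (@le_trans _ _ (\sum_(k <- zrange N) eta N' k * b k)).
    rewrite big_seq [leRHS]big_seq; apply: ler_sum => k; rewrite mem_zrange => kN.
    by rewrite etaE// (leq_trans kN)// leq_maxl.
  apply: ler_sum_subseq; [exact: zrange_uniq|exact: zrange_uniq| |].
    by move=> k; rewrite !mem_zrange => /leq_trans; apply; rewrite /M' /N'; lia.
  by move=> k; rewrite mulr_ge0.
have -> : \sum_(k <- zrange (M N')) eta N' k * b k =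
    \sum_(k <- zrange (M N')) eta N' k * a k + \sum_(k <- zrange (M N')) lapl (eta N') k * W k.
  rewrite -lapl_sum_by_parts; last by move=> k; exact: eta0.
  by rewrite -big_split/=; apply: eq_bigr => k _; rewrite -bW; ring.
rewrite EFinD; apply: leeD; last by rewrite lee_fin hx// leq_maxr.
apply: (@le_trans _ _ (\sum_(k <- zrange (M N')) phi k * a k)%:E).
  by rewrite lee_fin; apply: ler_sum => k _; rewrite ler_wpM2r.
by rewrite -sumEFin; apply: sum_le_esum => //; exact: zrange_uniq.
Qed.

Variable C : R.
Hypothesis eta_lapl : forall N k, `|lapl (eta N) k| <= C.
Hypothesis Wfin : (\esum_(k in [set: int]) `|W k|%:E < +oo)%E.

Lemma esum_lt_pinfty_of_test_functions :
  (\esum_(k in [set: int]) (phi k * a k)%:E < +oo)%E ->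
  (\esum_(k in [set: int]) (phi k * b k)%:E < +oo)%E.
Proof.
move=> afin; have := Wfin; set T := (\esum_(k in _) `|W k|%:E)%E => Toon.
have Tfin : T \is a fin_num.
  by rewrite ge0_fin_numE//; apply: esum_ge0 => k _; rewrite lee_fin.
have C0 : 0 <= C := le_trans (normr_ge0 _) (eta_lapl 0 0).
apply: (@le_lt_trans _ _ (\esum_(k in [set: int]) (phi k * a k)%:E + (C * fine T)%:E)%E).
  apply: (@esum_le_of_test_functions _ 0) => N _.
  apply: (@le_trans _ _ (\sum_(k <- zrange (M N)) C * `|W k|)).
    apply: ler_sum => k _; apply: le_trans (ler_norm _) _.
    by rewrite normrM ler_wpM2r.
  rewrite -mulr_sumr ler_wpM2l// -lee_fin fineK// -sumEFin.
  by apply: sum_le_esum => //; exact: zrange_uniq.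
by rewrite lte_add_pinfty// ltry.
Qed.

(** Near the origin the cutoff has the second difference of [phi], which contributes exactly
    [c W 0]; elsewhere it is bounded by [C] and meets only a tail of [W]. *)
Lemma esum_le_of_harmonic_test_functions (c : R) :
  (forall k, lapl phi k = c * (k == 0)%:R) ->
  (\esum_(k in [set: int]) (phi k * b k)%:E <=
   \esum_(k in [set: int]) (phi k * a k)%:E + (c * W 0)%:E)%E.
Proof.
move=> phic; apply/lee_addgt0Pr => e e0; rewrite -addeA -EFinD.
have C0 : 0 <= C := le_trans (normr_ge0 _) (eta_lapl 0 0).
(* [C + 1] stands in for [C], which may be zero. *)
have [N0 hN0] := esum_tail_small (divr_gt0 e0 (ltr_wpDl C0 ltr01)) Wfin.
(* The offset 2 ensures that a point with [|k| <= N0 + 1] has both neighbours where [eta N] equals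
   [phi]. *)
apply: (@esum_le_of_test_functions _ N0.+2) => N N0N.
have lapl_eq k : (`|k| <= N0.+1)%N -> lapl (eta N) k = lapl phi k.
  by move=> kN; rewrite /lapl !etaE//; lia.
rewrite (bigID (fun k : int => (N0.+1 < `|k|)%N))/= addrC lerD//.
  rewrite (eq_bigr (fun k => c * W 0 * (k == 0)%:R)); last first.
    move=> k; rewrite -leqNgt => kN; rewrite lapl_eq// phic.
    by case: eqP => [->|]; rewrite ?mulr1// !mulr0 mul0r.
  rewrite -mulr_sumr -big_filter (bigD1_seq 0); last 2 first.
  - by rewrite mem_filter mem_zrange.
  - exact/filter_uniq/zrange_uniq.
  - by rewrite eqxx big1/= ?addr0 ?mulr1// => k /negbTE ->.
apply: (@le_trans _ _ (\sum_(k <- zrange (M N) | (N0.+1 < `|k|)%N) C * `|W k|)).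
  apply: ler_sum => k _; apply: le_trans (ler_norm _) _.
  by rewrite normrM ler_wpM2r.
rewrite -mulr_sumr; apply: (@le_trans _ _ (C * (e / (C + 1)))).
  by rewrite ler_wpM2l// hN0.
rewrite mulrCA ler_piMr ?(ltW e0)// ler_pdivrMr; lra.
Qed.

End test_functions.

End summation_by_parts.

(** * Mass, centering and second moment *)

Section moment_conservation.
Context {R : realType}.
Implicit Types a b W : int -> R.

(** The hypotheses are symmetric under exchanging [a] with [b] and [W] with [-W], so the one-sided
    bound gives both inequalities. *)
Lemma esum_eq_of_harmonic_test_functions a b W (phi : int -> R)
    (eta : nat -> int -> R) (M : nat -> nat) (C c : R) :
  (forall k, 0 <= a k) -> (forall k, 0 <= b k) ->
  (forall k, b k - a k = lapl W k) ->
  (forall N k, 0 <= eta N k) -> (forall N k, eta N k <= phi k) ->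
  (forall N k, (`|k| <= N)%N -> eta N k = phi k) ->
  (forall N k, (M N <= `|k|)%N -> eta N k = 0) ->
  (forall N k, `|lapl (eta N) k| <= C) ->
  (\esum_(k in [set: int]) `|W k|%:E < +oo)%E ->
  (forall k, lapl phi k = c * (k == 0)%:R) ->
  (\esum_(k in [set: int]) (phi k * b k)%:E =
   \esum_(k in [set: int]) (phi k * a k)%:E + (c * W 0)%:E)%E.
Proof.
move=> a0 b0 bW h1 h2 h3 h4 h5 Wfin h6; apply/eqP; rewrite eq_le; apply/andP; split.
  exact: (esum_le_of_harmonic_test_functions a0 b0 bW h1 h2 h3 h4 h5 Wfin h6).
rewrite -leeBrDr// -EFinN -mulrN.
have bWN k : a k - b k = lapl (fun k => - W k) k.
  by rewrite -opprB bW /lapl mulNrn !opprD.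
have WfinN : (\esum_(k in [set: int]) `|- W k|%:E < +oo)%E.
  by under eq_esum do rewrite normrN.
exact: (esum_le_of_harmonic_test_functions b0 a0 bWN h1 h2 h3 h4 h5 WfinN h6).
Qed.

(** Tent truncation of the positive part of [k]: slope 1 up to [N], slope -1 from there down to 0 at
    [2 N]. *)
Definition ramp (N : nat) (k : int) : R := (Num.max 0 (Num.min k (N.*2%:Z - k)))%:~R.

Lemma max_min_lapl_le (N k : int) (f := fun k : int => Num.max 0 (Num.min k (N - k))) :
  `|f (k + 1) + f (k - 1) - f k *+ 2| <= 2.
Proof. rewrite /f; lia. Qed.

Lemma lapl_intr (f : int -> int) k : lapl (fun k => (f k)%:~R : R) k = (lapl f k)%:~R.
Proof. by rewrite /lapl rmorphB rmorphD rmorphMn. Qed.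

Lemma lapl_opp (V : zmodType) (f : int -> V) k : lapl (fun k => f (- k)) k = lapl f (- k).
Proof.
rewrite /lapl; congr (_ - _); rewrite addrC; congr (f _ + f _); lia.
Qed.

(** The second difference of [max 0 k] is the indicator of 0. The reflected weight has the same one,
    so the two half-moments increase equally, which is what preserves centering. *)
Lemma esum_pos_part_lapl a b W : (forall k, 0 <= a k) -> (forall k, 0 <= b k) ->
  (forall k, b k - a k = lapl W k) ->
  (\esum_(k in [set: int]) `|W k|%:E < +oo)%E ->
  (\esum_(k in [set: int]) ((Num.max 0 k)%:~R * b k)%:E =
   \esum_(k in [set: int]) ((Num.max 0 k)%:~R * a k)%:E + (W 0)%:E)%E.
Proof.
move=> a0 b0 bW Wfin; rewrite -[W 0]mul1r.
apply: (@esum_eq_of_harmonic_test_functions _ _ _ _ ramp (fun N => N.*2) 2) => //.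
- by move=> N k; rewrite /ramp ler0z; lia.
- by move=> N k; rewrite /ramp ler_int; lia.
- by move=> N k kN; rewrite /ramp; congr (_%:~R); lia.
- by move=> N k kN; rewrite /ramp (_ : Num.max _ _ = 0)//; lia.
- move=> N k; rewrite /ramp lapl_intr -intr_norm (_ : 2 = 2%:~R :> R)// ler_int.
  exact: max_min_lapl_le.
- move=> k; rewrite lapl_intr mul1r (_ : lapl _ _ = (k == 0)%:Z)// /lapl; lia.
Qed.

(** The constant weight is harmonic ([c = 0]), and its sharp cutoffs have second differences
    bounded, generously, by 4. *)
Lemma esum_lapl a b W : (forall k, 0 <= a k) -> (forall k, 0 <= b k) ->
  (forall k, b k - a k = lapl W k) ->
  (\esum_(k in [set: int]) `|W k|%:E < +oo)%E ->
  (\esum_(k in [set: int]) (b k)%:E = \esum_(k in [set: int]) (a k)%:E)%E.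
Proof.
move=> a0 b0 bW Wfin.
have := @esum_eq_of_harmonic_test_functions a b W (fun=> 1)
  (fun N k => if (`|k| <= N)%N then 1 else 0) S 4 0 a0 b0 bW.
have E (f : int -> R) :
    (\esum_(k in [set: int]) (1 * f k)%:E = \esum_(k in [set: int]) (f k)%:E)%E.
  by apply: eq_esum => k _; rewrite mul1r.
rewrite mul0r adde0 !E; apply => //.
- by move=> N k /=; case: (_ <= _)%N.
- by move=> N k /=; case: (_ <= _)%N.
- by move=> N k /= ->.
- by move=> N k /=; rewrite ltnNge => /negbTE ->.
- move=> N k; rewrite /lapl/=.
  case: (_ <= _)%N; case: (_ <= _)%N; case: (_ <= _)%N;
    rewrite /= ler_norml; apply/andP; split; lra.
- by move=> k; rewrite /lapl mul0r; lra.
Qed.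

(* Equal to [n ^+ 2] up to [N], zero from [4 * N] on, and glued by parabolas so
   that the second difference stays in [[-2, 2]]; meant for [n >= 0]. *)
Definition bump (N n : int) : int :=
  if n <= N then n ^+ 2 else
  if n <= 3 * N then 2 * N ^+ 2 - (n - 2 * N) ^+ 2 else
  if n <= 4 * N then (4 * N - n) ^+ 2 else 0.

Lemma bumpE1 N n : n <= N -> bump N n = n ^+ 2.
Proof. by rewrite /bump => ->. Qed.

(** Neighbouring formulas agree at the breakpoints, so each one holds on its closed piece. A second
    difference centred at a breakpoint then involves only two adjacent formulas. *)
Lemma bumpE2 N n : N <= n -> n <= 3 * N -> bump N n = 2 * N ^+ 2 - (n - 2 * N) ^+ 2.
Proof.
move=> h1 h2; rewrite /bump h2; case: ifPn => // h3.
have -> : n = N by lia.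
by ring.
Qed.

Lemma bumpE3 N n : 0 <= N -> 3 * N <= n -> n <= 4 * N -> bump N n = (4 * N - n) ^+ 2.
Proof.
move=> N0 h1 h2; have [e|h3] := eqVneq n (3 * N).
  by rewrite bumpE2 ?e; [ring|lia|lia].
by rewrite /bump h2 !ifF//; lia.
Qed.

Lemma bumpE4 N n : 0 <= N -> 4 * N <= n -> bump N n = 0.
Proof.
move=> N0 h1; have [e|h3] := eqVneq n (4 * N).
  by rewrite bumpE3 ?e; [ring|lia|lia|lia].
have [e|N1] := eqVneq N 0; first by rewrite /bump !ifF//; lia.
by rewrite /bump !ifF//; lia.
Qed.

Lemma bump_ge0 N n : 0 <= N -> 0 <= n -> 0 <= bump N n.
Proof.
move=> N0 n0; rewrite /bump; case: ifPn => [_|h1]; first exact: sqr_ge0.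
case: ifPn => [h2|h2]; last by case: ifPn => // _; exact: sqr_ge0.
by nia.
Qed.

Lemma bump_le N n : 0 <= N -> 0 <= n -> bump N n <= n ^+ 2.
Proof.
move=> N0 n0; rewrite /bump; case: ifPn => // h1.
case: ifPn => [h2|h2]; first by have := sqr_ge0 (n - N); nia.
by case: ifPn => [h3|h3]; [nia|exact: sqr_ge0].
Qed.

(** The second difference is 2, -2, 2 and 0 inside the successive pieces, and 0, 0 and 1 at [N],
    [3 N] and [4 N]. *)
Lemma bump_lapl N n : 1 <= N -> 1 <= n -> `|lapl (bump N) n| <= 2.
Proof.
move=> N1 n1; rewrite /lapl.
have [h|h] := ltP n N.
  by rewrite !bumpE1; [rewrite [X in `|X|](_ : _ = 2)//; ring|lia..].
have [e|h1] := eqVneq n N.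
  subst n; rewrite (bumpE1 (n := N))// (bumpE1 (n := N - 1)) ?bumpE2; [|lia..].
  by rewrite [X in `|X|](_ : _ = 0)//; ring.
have [h2|h2] := ltP n (3 * N).
  by rewrite !bumpE2; [rewrite [X in `|X|](_ : _ = - 2)//; ring|lia..].
have [e|h3] := eqVneq n (3 * N).
  rewrite (bumpE3 (n := n + 1)) ?(bumpE2 (n := n)) ?(bumpE2 (n := n - 1)); [|lia..].
  by rewrite e [X in `|X|](_ : _ = 0)//; ring.
have [h4|h4] := ltP n (4 * N).
  by rewrite !bumpE3; [rewrite [X in `|X|](_ : _ = 2)//; ring|lia..].
have [e|h5] := eqVneq n (4 * N).
  rewrite (bumpE4 (n := n + 1)) ?(bumpE4 (n := n)) ?(bumpE3 (n := n - 1)); [|lia..].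
  by rewrite e [X in `|X|](_ : _ = 1)//; ring.
by rewrite !bumpE4; [rewrite mul0rn subr0 addr0 normr0|lia..].
Qed.

Lemma bump_norm_lapl N k : 1 <= N -> `|lapl (fun k : int => bump N `|k|) k| <= 2.
Proof.
move=> N1; wlog k0 : k / 0 <= k.
  move=> h; have [|k0] := leP 0 k; first exact: h.
  have := h (- k); rewrite -lapl_opp.
  rewrite (_ : (fun k : int => _) = (fun k : int => bump N `|k|)).
    by apply; lia.
  by apply/funext => j; rewrite normrN.
have [->|k1] := eqVneq k 0.
  rewrite /lapl (_ : `|0 + 1| = 1)// (_ : `|0 - 1| = 1)// (_ : `|0| = 0)//.
  by rewrite !bumpE1//; lia.
have := @bump_lapl N k N1; rewrite /lapl.
by rewrite (ger0_norm (x := k)) ?(ger0_norm (x := k + 1))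
  ?(ger0_norm (x := k - 1)); [apply|..]; lia.
Qed.

(** The second difference of [k^2] is the constant 2, so this moment need not be conserved; cutoffs
    with uniformly bounded second differences still keep it finite. The index [N.+1] meets the
    condition [1 <= N] of [bump_norm_lapl]. *)
Lemma second_moment_lapl a b W : (forall k, 0 <= a k) -> (forall k, 0 <= b k) ->
  (forall k, b k - a k = lapl W k) ->
  (\esum_(k in [set: int]) `|W k|%:E < +oo)%E ->
  (\esum_(k in [set: int]) (k%:~R ^+ 2 * a k)%:E < +oo)%E ->
  (\esum_(k in [set: int]) (k%:~R ^+ 2 * b k)%:E < +oo)%E.
Proof.
move=> a0 b0 bW Wfin.
apply: (@esum_lt_pinfty_of_test_functions _ _ _ W a0 b0 bW _
  (fun N k => (bump N.+1 `|k|)%:~R) (fun N => 4 * N.+1)%N _ _ _ _ 2) => //.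
- by move=> N k; rewrite ler0z bump_ge0.
- move=> N k; rewrite -rmorphXn ler_int -[leRHS]real_normK ?num_real//.
  by rewrite bump_le.
- move=> N k kN; rewrite bumpE1; last by lia.
  by rewrite real_normK ?num_real// rmorphXn.
- by move=> N k kN; rewrite bumpE4//; lia.
- move=> N k; rewrite lapl_intr -intr_norm (_ : 2 = 2%:~R :> R)// ler_int.
  exact: bump_norm_lapl.
Qed.

Lemma P2c_dlap (delta : R) a b W : 0 < delta -> P2c delta a ->
  (forall k, 0 <= b k) -> (forall k, b k - a k = dlap delta W k) ->
  (\esum_(k in [set: int]) `|W k|%:E < +oo)%E -> P2c delta b.
Proof.
move=> d0 [a0 [am [a2 a1]]] b0 bW Wfin.
pose W' k := W k / delta ^+ 2.
have bW' k : b k - a k = lapl W' k.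
  by rewrite bW /dlap /lapl /W' -mulrnAl -mulrDl -mulrBl mulr_natl.
have Wfin' : (\esum_(k in [set: int]) `|W' k|%:E < +oo)%E.
  rewrite (eq_esum (b := fun k => (delta ^- 2)%:E * `|W k|%:E)%E).
    rewrite esumZl//; last by rewrite invr_ge0 sqr_ge0.
    by rewrite lte_mul_pinfty// lee_fin invr_ge0 sqr_ge0.
  move=> k _; rewrite /W' normrM mulrC EFinM ger0_norm// invr_ge0 sqr_ge0//.
have mom2 (f : int -> R) : (forall k, 0 <= f k) ->
    (\esum_(k in [set: int]) ((delta * k%:~R) ^+ 2 * f k)%:E =
     (delta ^+ 2)%:E * \esum_(k in [set: int]) (k%:~R ^+ 2 * f k)%:E)%E.
  move=> f0; rewrite -esumZl ?sqr_ge0//; last first.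
    by move=> k _; rewrite lee_fin mulr_ge0// sqr_ge0.
  by apply: eq_esum => k _; rewrite -EFinM exprMn -mulrA.
have momp (f : int -> R) : (forall k, 0 <= f k) ->
    (\esum_(k in [set k : int | (0 < k)%R]) ((delta * k%:~R) * f k)%:E =
     delta%:E * \esum_(k in [set: int]) ((Num.max 0 k)%:~R * f k)%:E)%E.
  move=> f0; rewrite -esumZl ?ltW//; last first.
    by move=> k _; rewrite lee_fin mulr_ge0// ler0z; lia.
  rewrite esum_mkcond; apply: eq_esum => k _; rewrite -EFinM.
  case: ifPn; rewrite ?notin_setE ?inE/= => k0.
    by rewrite max_r ?ltW// mulrA.
  by rewrite max_l; [rewrite mul0r mulr0|lia].
have momn (f : int -> R) : (forall k, 0 <= f k) ->
    (\esum_(k in [set k : int | (k < 0)%R]) (- (delta * k%:~R) * f k)%:E =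
     delta%:E * \esum_(k in [set: int]) ((Num.max 0 k)%:~R * f (- k))%:E)%E.
  move=> f0; rewrite -momp//.
  rewrite (reindex_esum [set k : int | (0 < k)%R] _ (fun k => - k)).
    by apply: eq_esum => k _; rewrite rmorphN/= mulrN opprK.
  split => /=.
  - by move=> k /=; rewrite oppr_lt0.
  - by move=> i j _ _ /oppr_inj.
  - by move=> k /= k0; exists (- k) => //=; [rewrite oppr_gt0|rewrite opprK].
have bm := esum_lapl a0 b0 bW' Wfin'.
split=> //; split; first by rewrite bm.
split.
  rewrite mom2// lte_mul_pinfty ?lee_fin ?(ltW d0)// lte_mul_pinfty ?lee_fin ?sqr_ge0//.
  apply: (second_moment_lapl a0 b0 bW' Wfin').
  rewrite ltNge leye_eq; apply/eqP => E; move: a2.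
  by rewrite mom2// E gt0_muley ?lte_fin ?exprn_gt0// gt0_muley ?lte_fin ?ltxx.
rewrite momp// momn//.
rewrite momp// momn// in a1.
(* Reflection turns the negative half-moment into a positive one; both grow by [W' 0], so their
   balance persists. *)
have bWn k : b (- k) - a (- k) = lapl (fun k => W' (- k)) k by rewrite lapl_opp.
have Wfinn : (\esum_(k in [set: int]) `|W' (- k)|%:E < +oo)%E.
  rewrite -(reindex_esum [set: int] [set: int] (fun k => - k) (fun k => `|W' k|%:E))//.
rewrite (esum_pos_part_lapl a0 b0 bW' Wfin').
rewrite (esum_pos_part_lapl (fun k => a0 (- k)) (fun k => b0 (- k)) bWn Wfinn) oppr0.
(* The half-moments are extended reals, so [delta] is cancelled by multiplying with its inverse. *)
have inj (x y : \bar R) : (delta%:E * (delta%:E * x) = delta%:E * (delta%:E * y) -> x = y)%E.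
  have H (z : \bar R) : ((delta^-1 * delta^-1)%:E * (delta%:E * (delta%:E * z)) = z)%E.
    by rewrite !muleA -!EFinM (_ : _ * _ = 1) ?mul1e//; field; rewrite gt_eqF.
  by move=> /(congr1 (fun z => (delta^-1 * delta^-1)%:E * z)%E); rewrite !H.
by rewrite (inj _ _ a1).
Qed.

End moment_conservation.

(** * Paths of finite action *)

Section integrability.
Context {R : realType}.
Local Notation mu := (@lebesgue_measure R).
Implicit Types (D : set R) (f g : R -> R).

(** On a set of finite measure, [|f| <= 1 + f^2] suffices. *)
Lemma integrable_of_square D f : measurable D -> (mu D < +oo)%E ->
  measurable_fun D f -> (\int[mu]_(s in D) ((f s) ^+ 2)%:E < +oo)%E ->
  mu.-integrable D (EFin \o f).
Proof.
move=> mD Dfin mf f2.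
apply: (@le_integrable _ _ _ mu D mD _ (fun s => 1 + ((f s) ^+ 2)%:E)%E).
- exact/measurable_EFinP.
- move=> s Ds /=; rewrite lee_fin [leRHS]ger0_norm ?addr_ge0 ?sqr_ge0//.
  by have := sqr_ge0 (`|f s| - 1); rewrite -(real_normK (num_real (f s))); nra.
- apply: integrableD => //.
    by apply/integrableP; split => //=; rewrite normr1 integral_cst// mul1e.
  apply/integrableP; split; first exact/measurable_EFinP/measurable_funX.
  by under eq_integral do rewrite gee0_abs ?lee_fin ?sqr_ge0//.
Qed.

Lemma integrable_dlap (delta : R) D (w : R -> int -> R) k : measurable D ->
  (forall j, mu.-integrable D (fun s => (w s j)%:E)) ->
  mu.-integrable D (fun s => (dlap delta (w s) k)%:E).
Proof.
move=> mD iw.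
rewrite (_ : (fun s => _) = (fun s => (delta ^- 2)%:E *
  (((w s (k + 1))%:E + (w s (k - 1))%:E) - 2%:E * (w s k)%:E)))%E; last first.
  by apply/funext => s; rewrite /dlap mulrC.
apply: integrableZl => //; apply: integrableB => //; first exact: integrableD.
exact: integrableZl.
Qed.

Lemma integral_dlap (delta : R) D (w : R -> int -> R) k : measurable D ->
  (forall j, mu.-integrable D (fun s => (w s j)%:E)) ->
  (\int[mu]_(s in D) (dlap delta (w s) k)%:E =
   (dlap delta (fun j => \int[mu]_(s in D) (w s j)) k)%:E)%E.
Proof.
move=> mD iw.
transitivity (\int[mu]_(s in D) ((delta ^- 2)%:E *
  (((w s (k + 1))%:E + (w s (k - 1))%:E) - 2%:E * (w s k)%:E)))%E.
  by apply: eq_integral => s _; rewrite /dlap mulrC.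
rewrite integralZl//; last first.
  by apply: integrableB => //; [exact: integrableD|exact: integrableZl].
rewrite integralB//; [|exact: integrableD|exact: integrableZl].
rewrite integralD// integralZl//.
have E j : (\int[mu]_(s in D) (w s j)%:E = (\int[mu]_(s in D) (w s j))%:E)%E.
  by rewrite /Rintegral fineK//; exact: (integrable_fin_num _ (iw j)).
by rewrite !E /dlap mulrC.
Qed.

Lemma continuous_of_integral (r g : R -> R) :
  mu.-integrable `[0, 1] (EFin \o g) ->
  (forall t, t \in `[0, 1] ->
    ((r t - r 0)%:E = \int[mu]_(s in `[0%R, t]) (g s)%:E)%E) ->
  {within `[0, 1], continuous r}.
Proof.
move=> ig h.
have c := @parameterized_integral_continuous R 0 1 g ler01 ig.
apply: (@subspace_eq_continuous _ _ _ (fun t => parameterized_integral mu 0 t g + r 0)).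
  move=> t /set_mem /= t01; rewrite /parameterized_integral /Rintegral.
  by rewrite /= -h//= subrK.
move=> t; apply: cvgD; first exact: c.
exact: cvg_cst.
Qed.

End integrability.

Section paths.
Context {R : realType} (delta : R).
Hypothesis delta_gt0 : 0 < delta.
Local Notation mu := (@lebesgue_measure R).
Local Notation I01 := (`[0%R, 1%R]%classic : set R).
Implicit Types (rho w : R -> int -> R) (x y : int -> R).

Lemma mu_I01 : mu I01 = 1%E.
Proof. by rewrite lebesgue_measure_itv/= lte_fin ltr01 -EFinB subr0. Qed.

Lemma P2c_mass x : P2c delta x -> (\esum_(k in [set: int]) (x k)%:E = delta^-1%:E)%E.
Proof.
case=> x0 [m _]; rewrite -[LHS]mul1e -(mulVf (lt0r_neq0 delta_gt0)) EFinM -muleA.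
by rewrite m mule1.
Qed.

Lemma esum_term_le x k : (\esum_(k in [set: int]) (x k)%:E <= delta^-1%:E)%E ->
  x k <= delta^-1.
Proof. by move=> h; rewrite -lee_fin; apply: le_trans h; exact: term_le_esum. Qed.

Lemma action_lt_pinfty rho w : (action delta rho w < +oo)%E ->
  (\esum_(k in [set: int]) \int[mu]_(s in I01) Qf (w s k) (rho s k) < +oo)%E.
Proof.
move=> h; rewrite ltNge leye_eq; apply/eqP => E; move: h.
by rewrite /action E gt0_muley ?lte_fin// ltxx.
Qed.

Lemma sqr_integral_le_Qf rho w k :
  (forall s, I01 s -> 0 <= rho s k <= delta^-1) ->
  measurable_fun I01 (fun s => rho s k) -> measurable_fun I01 (fun s => w s k) ->
  (\int[mu]_(s in I01) ((w s k) ^+ 2)%:E <=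
   delta^-1%:E * \int[mu]_(s in I01) Qf (w s k) (rho s k))%E.
Proof.
move=> h mr mw.
have mQ : measurable_fun I01 (fun s => Qf (w s k) (rho s k)) by exact: measurable_fun_Qf.
rewrite -ge0_integralZl//; [|by move=> s _; exact: Qf_ge0|by rewrite lee_fin invr_ge0 ltW].
apply: ge0_le_integral => //.
- by move=> s _; rewrite lee_fin sqr_ge0.
- exact/measurable_EFinP/measurable_funX.
- exact: emeasurable_funM.
- by move=> s /h /andP[r0 rd]; apply: sqr_le_Qf; rewrite ?invr_gt0.
Qed.

(** * Admissibility from finite action *)

Section finite_action.
Variables (rho w : R -> int -> R) (x y : int -> R).
Hypothesis rho_ge0 : forall s k, I01 s -> 0 <= rho s k.
Hypothesis rho_mass : forall s, I01 s ->
  (\esum_(k in [set: int]) (rho s k)%:E <= delta^-1%:E)%E.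
Hypothesis rho_cont : forall k, {within I01, continuous (fun s => rho s k)}.
Hypothesis w_meas : forall k, measurable_fun I01 (fun s => w s k).
Hypothesis fin_action : (action delta rho w < +oo)%E.

Let rho_meas k : measurable_fun I01 (fun s => rho s k).
Proof. by apply: subspace_continuous_measurable_fun => //; exact: rho_cont. Qed.

Let mQ k : measurable_fun I01 (fun s => Qf (w s k) (rho s k)).
Proof. exact: measurable_fun_Qf. Qed.

Let Q_fin := action_lt_pinfty fin_action.

Lemma finite_action_sqr k : (\int[mu]_(s in I01) ((w s k) ^+ 2)%:E < +oo)%E.
Proof.
apply: le_lt_trans (@sqr_integral_le_Qf rho w k _ (rho_meas k) (w_meas k)) _.
  by move=> s Is; rewrite rho_ge0// esum_term_le// rho_mass.
rewrite lte_mul_pinfty ?lee_fin ?invr_ge0 ?(ltW delta_gt0)//.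
apply: le_lt_trans Q_fin.
exact: (@term_le_esum _ _ _ (fun k => \int[mu]_(s in I01) Qf (w s k) (rho s k))%E).
Qed.

Lemma finite_action_integrable k : mu.-integrable I01 (fun s => (w s k)%:E).
Proof.
apply: integrable_of_square => //; last exact: finite_action_sqr.
by rewrite [ltLHS]mu_I01 ltry.
Qed.

Lemma finite_action_L1 : (\esum_(k in [set: int]) \int[mu]_(s in I01) `|w s k|%:E < +oo)%E.
Proof.
have mn k : measurable_fun I01 (fun s => `|w s k|%:E).
  by apply/measurable_EFinP; exact: measurableT_comp.
have mr k : measurable_fun I01 (fun s => (rho s k)%:E) by exact/measurable_EFinP.
have h k : (\int[mu]_(s in I01) `|w s k|%:E <= \int[mu]_(s in I01) Qf (w s k) (rho s k)
    + \int[mu]_(s in I01) (rho s k)%:E)%E.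
  rewrite -ge0_integralD//; [|by move=> s _; exact: Qf_ge0|exact: mQ|
    by move=> s Is; rewrite lee_fin rho_ge0|exact: mr].
  apply: ge0_le_integral => //; [exact: mn|apply: emeasurable_funD; [exact: mQ|exact: mr]|].
  move=> s Is; apply: le_trans (norm_le_Qf (w s k) (rho_ge0 k Is)).
  by rewrite lee_fin ler_peMl// ler1n.
apply: (@le_lt_trans _ _ (\esum_(k in [set: int])
  (\int[mu]_(s in I01) Qf (w s k) (rho s k) + \int[mu]_(s in I01) (rho s k)%:E))%E).
  by apply: le_esum => k _; exact: h.
rewrite esumD; last 2 first.
- by move=> k _; apply: integral_ge0 => s _; exact: Qf_ge0.
- by move=> k _; apply: integral_ge0 => s Is; rewrite lee_fin rho_ge0.
(* After exchanging sum and integral, the second term is the time integral of the mass, at most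
   [delta^-1] on the unit interval. *)
rewrite lte_add_pinfty// -integral_esum_int//; last first.
  by move=> k s Is; rewrite lee_fin rho_ge0.
apply: (@le_lt_trans _ _ (\int[mu]_(s in I01) (delta^-1)%:E)%E).
  apply: ge0_le_integral => //.
  - by move=> s Is; apply: esum_ge0 => k _; rewrite lee_fin rho_ge0.
  - by apply: measurable_fun_esum_int => // k s Is; rewrite lee_fin rho_ge0.
by rewrite integral_cst// [X in (_ * X)%E]mu_I01 mule1 ltry.
Qed.

Hypothesis Px : P2c delta x.
Hypothesis rho_w : forall t k, t \in `[0%R, 1%R] ->
  ((rho t k - rho 0 k)%:E = \int[mu]_(s in `[0%R, t]) (dlap delta (w s) k)%:E)%E.
Hypothesis rho0 : rho 0 = x.
Hypothesis rho1 : rho 1 = y.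

(** Only an upper bound on the mass is assumed along the path; its exact value, like the other
    moment conditions, is carried over from [x] by the continuity equation. *)
Lemma finite_action_P2c t : I01 t -> P2c delta (rho t).
Proof.
move=> It.
have tI : `[0%R, t] `<=` I01 by move: It; rewrite /= in_itv/= => /andP[t0 t1]; exact: subset_itvl.
have iw k : mu.-integrable `[0%R, t] (fun s => (w s k)%:E).
  by apply: integrableS (finite_action_integrable k).
(* The total flux up to time [t] plays the role of [W]; [finite_action_L1] puts it in l^1. *)
apply: (@P2c_dlap _ _ _ _ (fun k => \int[mu]_(s in `[0%R, t]) (w s k)) delta_gt0 Px).
- by move=> k; exact: rho_ge0.
- by move=> k; apply: EFin_inj; rewrite -rho0 rho_w// integral_dlap.
- apply: le_lt_trans finite_action_L1; apply: le_esum => k _.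
  apply: (@le_trans _ _ (\int[mu]_(s in `[0%R, t]) `|w s k|%:E)%E).
    rewrite -abse_EFin /Rintegral fineK; last exact: (integrable_fin_num _ (iw k)).
    by apply: le_abse_integral => //; exact: (measurable_int _ (iw k)).
  apply: ge0_subset_integral => //.
  by apply/measurable_EFinP; apply: measurableT_comp => //; exact: w_meas.
Qed.

(* Finiteness of the action gives [w s] in l^2 only for almost every [s], so
   [w] is set to zero on the exceptional null set. *)
Lemma inC_of_finite_action :
  exists w', inC delta x y rho w' /\ action delta rho w' = action delta rho w.
Proof.
pose g s := (\esum_(k in [set: int]) Qf (w s k) (rho s k))%E.
have mg : measurable_fun I01 g.
  by apply: measurable_fun_esum_int => // k s _; exact: Qf_ge0.
have g0 s : (0 <= g s)%E by apply: esum_ge0 => k _; exact: Qf_ge0.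
have ig : mu.-integrable I01 g.
  apply/integrableP; split=> //.
  under eq_integral do rewrite gee0_abs//.
  rewrite integral_esum_int// => k s _; exact: Qf_ge0.
(* Up to the factor [delta], [g] is the action density in time. It is integrable, so [G] has full
   measure in the interval, and on [G] the bound [w^2 <= delta^-1 Q] is summable in [k]. *)
pose G := I01 `&` [set s | g s \is a fin_num].
have mG : measurable G by exact: emeasurable_fin_num.
pose w' s k := \1_G s * w s k.
have mw' k : measurable_fun I01 (fun s => w' s k).
  by apply: measurable_funM; [exact: measurable_indic|exact: w_meas].
have ae1 : \forall s \ae mu, I01 s -> w' s = w s.
  apply: filterS (integrable_ae _ ig) => // s h Is.
  by apply/funext => k; rewrite /w' indicE mem_set ?mul1r//; split => //; exact: h.
have act : action delta rho w' = action delta rho w.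
  congr (_ * _)%E; apply: eq_esum => k _; apply: ae_eq_integral => //.
  - by apply: measurable_fun_Qf; [by []|exact: mw'|exact: rho_meas].
  - exact: mQ.
  -  by apply: (@filterS _ _ (ae_filter_ringOfSetsType mu) _ _ _ ae1) => s h Is; rewrite h.
exists w'; split => //; split; first by move=> s Is; exact: finite_action_P2c.
split.
  move=> s Is; have [Gs|Gs] := pselect (G s); last first.
    rewrite esum1 ?ltry// => k _.
    by rewrite /w' indicE memNset// mul0r expr0n.
  apply: (@le_lt_trans _ _ (\esum_(k in [set: int]) (delta^-1%:E * Qf (w s k) (rho s k)))%E).
    apply: le_esum => k _; rewrite /w' indicE mem_set// mul1r.
    apply: sqr_le_Qf; rewrite ?invr_gt0// ?rho_ge0//.
    by rewrite esum_term_le// rho_mass.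
  rewrite esumZl ?invr_ge0 ?(ltW delta_gt0)//; last by move=> k _; exact: Qf_ge0.
  rewrite lte_mul_pinfty ?lee_fin ?invr_ge0 ?(ltW delta_gt0)//.
  by case: Gs => _ /=; rewrite ge0_fin_numE.
split; last by [].
move=> k; split => //; split => //; split.
  have -> : (\int[mu]_(s in I01) ((w' s k) ^+ 2)%:E = \int[mu]_(s in I01) ((w s k) ^+ 2)%:E)%E.
    apply: ae_eq_integral => //.
    - by apply/measurable_EFinP; apply: measurable_funX; exact: mw'.
    - by apply/measurable_EFinP; apply: measurable_funX; exact: w_meas.
    - by apply: (@filterS _ _ (ae_filter_ringOfSetsType mu) _ _ _ ae1) => s h Is; rewrite h.
  exact: finite_action_sqr.
move=> t It; rewrite rho_w//.
have tI : `[0%R, t] `<=` I01 by move: It; rewrite /= in_itv/= => /andP[t0 t1]; exact: subset_itvl.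
have md v : (forall k, measurable_fun I01 (fun s => v s k)) ->
    measurable_fun `[0%R, t] (fun s => (dlap delta (v s) k)%:E).
  move=> mv; apply: measurable_funS tI _ => //.
  apply/measurable_EFinP; apply: measurable_funM => //; apply: measurable_funB.
    by apply: measurable_funD; exact: mv.
  by apply: measurable_funM => //; exact: mv.
apply: ae_eq_integral => //; [exact: md|exact: md|].
by apply: (@filterS _ _ (ae_filter_ringOfSetsType mu) _ _ _ ae1) => s h Is; rewrite h//; exact: tI.
Qed.

End finite_action.
End paths.

(** * Reversal and concatenation *)

Section paste.
Context {R : realType}.
Local Notation mu := (@lebesgue_measure R).

Definition paste (T : Type) (c : R) (f g : R -> T) (s : R) : T :=
  if s <= c then f s else g s.

Lemma paste_itvE (a b c : R) : a <= c -> c <= b ->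
  `[a, b]%classic = `[a, c]%classic `|` `]c, b]%classic.
Proof.
by move=> ac cb; rewrite -itv_bndbnd_setU// bnd_simp.
Qed.

Lemma measurable_fun_paste d (T : measurableType d) (a b c : R) (f g : R -> T) :
  a <= c -> c <= b -> measurable_fun `[a, c] f -> measurable_fun `[c, b] g ->
  measurable_fun `[a, b] (paste c f g).
Proof.
move=> ac cb mf mg; rewrite (paste_itvE ac cb).
apply/measurable_funU => //; split.
  apply: eq_measurable_fun mf => s /set_mem/=; rewrite in_itv/= => /andP[_ sc].
  by rewrite /paste sc.
apply: (@eq_measurable_fun _ _ _ _ _ g).
  move=> s /set_mem/=; rewrite in_itv/= => /andP[cs _].
  by rewrite /paste leNgt cs.
by apply: measurable_funS mg => //; apply: subset_itvr; rewrite bnd_simp.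
Qed.

(** The point [c] belongs to both intervals on the right, which is harmless because it is a null
    set. *)
Lemma integral_paste (a b c : R) (f g : R -> \bar R) :
  a <= c -> c <= b -> measurable_fun `[a, c] f -> measurable_fun `[c, b] g ->
  (\int[mu]_(s in `[a, b]) paste c f g s =
   \int[mu]_(s in `[a, c]) f s + \int[mu]_(s in `[c, b]) g s)%E.
Proof.
move=> ac cb mf mg; have mp := measurable_fun_paste ac cb mf mg.
rewrite (paste_itvE ac cb) in mp *.
rewrite integral_setU//; last first.
  apply/disj_set2P; rewrite -subset0 => s /= []; rewrite !in_itv/= => /andP[_ h1] /andP[h2 _].
  by move: h1; rewrite leNgt h2.
congr (_ + _)%E.
  apply: eq_integral => s /set_mem/=; rewrite in_itv/= => /andP[_ sc].
  by rewrite /paste sc.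
rewrite -integral_itv_obnd_cbnd; last first.
  by apply: measurable_funS mg => //; apply: subset_itvr; rewrite bnd_simp.
apply: eq_integral => s /set_mem/=; rewrite in_itv/= => /andP[cs _].
by rewrite /paste leNgt cs.
Qed.

Lemma integral_itv_split (a b c : R) (f : R -> \bar R) :
  a <= c -> c <= b -> measurable_fun `[a, b] f ->
  (\int[mu]_(s in `[a, b]) f s =
   \int[mu]_(s in `[a, c]) f s + \int[mu]_(s in `[c, b]) f s)%E.
Proof.
move=> ac cb mf; rewrite -integral_paste//.
- by apply: eq_integral => s _; rewrite /paste; case: ifP.
- by apply: measurable_funS mf => //; apply: subset_itvl.
- by apply: measurable_funS mf => //; apply: subset_itvr.
Qed.

Lemma affine_preimage_cc (c d a b : R) : 0 < c ->
  affine c d @^-1` `[affine c d a, affine c d b]%classic = `[a, b]%classic.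
Proof.
move=> c0; apply/seteqP; split => s /=; rewrite !in_itv/= /affine !lerD2r !ler_pM2l//.
Qed.

Lemma affine_preimage_ccN (c d a b : R) : c < 0 ->
  affine c d @^-1` `[affine c d b, affine c d a]%classic = `[a, b]%classic.
Proof.
move=> c0; apply/seteqP; split => s /=; rewrite !in_itv/= /affine !lerD2r !ler_nM2l//;
  by rewrite andbC.
Qed.

End paste.

Section path_operations.
Context {R : realType} (delta : R).
Hypothesis delta_gt0 : 0 < delta.
Local Notation mu := (@lebesgue_measure R).
Local Notation I01 := (`[0%R, 1%R]%classic : set R).
Implicit Types (rho w : R -> int -> R) (x y : int -> R).

Lemma inC_ge0 x y rho w s k : inC delta x y rho w -> I01 s -> 0 <= rho s k.
Proof. by case=> P _ Is; have [] := P s Is. Qed.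

Lemma inC_mass x y rho w s : inC delta x y rho w -> I01 s ->
  (\esum_(k in [set: int]) (rho s k)%:E <= delta^-1%:E)%E.
Proof. by case=> P _ Is; rewrite (P2c_mass delta_gt0 (P s Is)). Qed.

Lemma inC_rho_measurable x y rho w k : inC delta x y rho w ->
  measurable_fun I01 (fun s => rho s k).
Proof.
by move=> [_ [_ [/(_ k)[c _] _]]]; exact: subspace_continuous_measurable_fun.
Qed.

Lemma inC_w_measurable x y rho w k : inC delta x y rho w ->
  measurable_fun I01 (fun s => w s k).
Proof. by move=> [_ [_ [/(_ k)[_ []]]]]. Qed.

Lemma inC_Qf_measurable x y rho w k : inC delta x y rho w ->
  measurable_fun I01 (fun s => Qf (w s k) (rho s k)).
Proof.
move=> H; apply: measurable_fun_Qf => //; [exact: inC_w_measurable H|exact: inC_rho_measurable H].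
Qed.

Lemma inC_w_integrable x y rho w k : inC delta x y rho w ->
  mu.-integrable I01 (fun s => (w s k)%:E).
Proof.
move=> H; apply: integrable_of_square => //.
- by rewrite [ltLHS]mu_I01 ltry.
- exact: inC_w_measurable H.
- by case: H => [_ [_ [/(_ k)[_ [_ []]]]]].
Qed.

Lemma inC_start x y rho w : inC delta x y rho w -> rho 0 = x.
Proof. by move=> [_ [_ [_ []]]]. Qed.

Lemma inC_end x y rho w : inC delta x y rho w -> rho 1 = y.
Proof. by move=> [_ [_ [_ []]]]. Qed.

Lemma inC_P2c x y rho w : inC delta x y rho w -> P2c delta x /\ P2c delta y.
Proof.
move=> H; rewrite -(inC_start H) -(inC_end H); case: H => P _.
by split; apply: P; rewrite in_itv/= ?lexx ?ler01.
Qed.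

Lemma inC_increment x y rho w a b k : inC delta x y rho w ->
  0 <= a -> a <= b -> b <= 1 ->
  ((rho b k - rho a k)%:E = \int[mu]_(s in `[a, b]) (dlap delta (w s) k)%:E)%E.
Proof.
move=> H a0 ab b1.
have ib : mu.-integrable `[0%R, b] (fun s => (dlap delta (w s) k)%:E).
  apply: integrable_dlap => // j.
  by apply: integrableS (inC_w_integrable j H) => //; exact: subset_itvl.
have ia : mu.-integrable `[0%R, a] (fun s => (dlap delta (w s) k)%:E).
  by apply: integrableS ib => //; exact: subset_itvl.
have [_ [_ [/(_ k)[_ [_ [_ id]]] _]]] := H.
have eb := id b; rewrite in_itv/= b1 (le_trans a0 ab) in eb.
have ea := id a; rewrite in_itv/= a0 (le_trans ab b1) in ea.
have := eb isT; rewrite (integral_itv_split a0 ab); last exact: (measurable_int _ ib).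
rewrite -ea// => h.
have -> : rho b k - rho a k = (rho b k - rho 0 k) - (rho a k - rho 0 k) by ring.
by rewrite EFinB h [X in (X - _)%E]addeC addeK.
Qed.

Lemma dlap_scale c (f : int -> R) k : dlap delta (fun j => c * f j) k = c * dlap delta f k.
Proof. by rewrite /dlap; ring. Qed.

(** * Affine reparametrization of time *)

Section reparametrization.
Variables (rho w : R -> int -> R) (x y : int -> R) (c d : R).
Hypothesis H : inC delta x y rho w.
Hypothesis c0 : c != 0.
Let I' : set R := affine c d @^-1` I01.

Lemma measurable_reparam : measurable I'.
Proof. exact: measurable_affine_preimage. Qed.

Lemma rho_reparam_measurable k : measurable_fun I' (fun s => rho (affine c d s) k).
Proof.
exact: (@measurable_fun_affine _ _ _ c d _ (fun s => rho s k) _ (inC_rho_measurable k H)).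
Qed.

Lemma w_reparam_measurable k : measurable_fun I' (fun s => c * w (affine c d s) k).
Proof.
apply: measurable_funM => //.
exact: (@measurable_fun_affine _ _ _ c d _ (fun s => w s k) _ (inC_w_measurable k H)).
Qed.

Lemma w_reparam_integrable k : mu.-integrable I' (fun s => (c * w (affine c d s) k)%:E).
Proof.
have [] := @integral_affine _ c d I01 (fun s => (w s k)%:E) c0 _ (inC_w_integrable k H) => //.
move=> h _; have := @integrableZl _ _ _ mu I' measurable_reparam c _ h.
by [].
Qed.

(** Homogeneity of [Q] in the flux gives [c^2], and the change of variables divides by [|c|]. *)
Lemma integral_Qf_reparam k :
  (\int[mu]_(s in I') Qf (c * w (affine c d s) k) (rho (affine c d s) k) =
   `|c|%:E * \int[mu]_(s in I01) Qf (w s k) (rho s k))%E.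
Proof.
have mQ := inC_Qf_measurable k H.
rewrite (@ge0_integral_affine _ c d I01 (fun s => Qf (w s k) (rho s k)))//; last first.
  by move=> s _; exact: Qf_ge0.
rewrite muleA -EFinM -expr2 real_normK ?num_real//.
rewrite -ge0_integralZl//.
- by apply: eq_integral => s _; exact: Qf_scale.
- exact: measurable_reparam.
- exact: (@measurable_fun_affine _ _ _ c d _ (fun s => Qf (w s k) (rho s k)) _ mQ).
- by move=> s _; exact: Qf_ge0.
- by rewrite lee_fin sqr_ge0.
Qed.

(** For [c < 0] the image interval is traversed backwards, and this sign cancels the one carried by
    the factor [c]. *)
Lemma reparam_increment a b k : a <= b -> I' a -> I' b ->
  ((rho (affine c d b) k - rho (affine c d a) k)%:E =
   \int[mu]_(s in `[a, b]) (dlap delta (fun j => c * w (affine c d s) j) k)%:E)%E.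
Proof.
move=> ab; rewrite /I' /= !in_itv/= => /andP[a0 a1] /andP[b0 b1].
have gi u v : 0 <= u -> v <= 1 -> mu.-integrable `[u, v] (fun s => (dlap delta (w s) k)%:E).
  move=> u0 v1; apply: integrable_dlap => // j.
  by apply: integrableS (inC_w_integrable j H) => //; exact: subset_itv.
under eq_integral do rewrite dlap_scale EFinM.
have := c0; rewrite neq_lt => /orP[cn|cp].
- have := @integral_affine _ c d `[affine c d b, affine c d a]%classic _ c0 _ (gi _ _ b0 a1).
  rewrite affine_preimage_ccN// => -[//|ig eg].
  rewrite -opprB EFinN (inC_increment _ H b0 _ a1); last first.
    by rewrite /affine lerD2r ler_nM2l.
  by rewrite integralZl// eg ltr0_norm// EFinN mulNe oppeK.
- have := @integral_affine _ c d `[affine c d a, affine c d b]%classic _ c0 _ (gi _ _ a0 b1).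
  rewrite affine_preimage_cc// => -[//|ig eg].
  rewrite (inC_increment _ H a0 _ b1); last first.
    by rewrite /affine lerD2r ler_pM2l.
  by rewrite integralZl// eg gtr0_norm.
Qed.

End reparametrization.

(** The case [c = -1], [d = 1] of the reparametrization: the flux changes sign, and [Q] is even in
    it. *)
Lemma inC_reverse x y rho w : inC delta x y rho w -> (action delta rho w < +oo)%E ->
  exists rho' w', inC delta y x rho' w' /\ action delta rho' w' = action delta rho w.
Proof.
move=> H fin; have [Px Py] := inC_P2c H.
have c0 : (-1 : R) != 0 by rewrite oppr_eq0 oner_eq0.
have E : affine (-1) 1 @^-1` I01 = I01.
  by apply/seteqP; split => s /=; rewrite !in_itv/= /affine => /andP[? ?]; apply/andP; split; lra.
have a0 : affine (-1) 1 0 = 1 :> R by rewrite /affine mulr0 add0r.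
have a1 : affine (-1) 1 1 = 0 :> R by rewrite /affine mulr1 addNr.
have I01E s : I01 s -> I01 (affine (-1) 1 s) by rewrite -{1}E.
pose rho' s := rho (affine (-1) 1 s); pose w' s k := -1 * w (affine (-1) 1 s) k.
have act : action delta rho' w' = action delta rho w.
  congr (_ * _)%E; apply: eq_esum => k _.
  by have := integral_Qf_reparam 1 H c0 k; rewrite E normrN1 mul1e.
exists rho'.
have id t k : I01 t -> ((rho' t k - rho' 0 k)%:E =
    \int[mu]_(s in `[0%R, t]) (dlap delta (w' s) k)%:E)%E.
  move=> It; have := It; rewrite /= in_itv/= => /andP[t0 t1].
  by apply: (reparam_increment H c0); rewrite ?E//= in_itv/= lexx ler01.
have [w'' [Hw Aw]] : exists w'', inC delta y x rho' w'' /\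
    action delta rho' w'' = action delta rho' w'.
  apply: inC_of_finite_action => //.
  - by move=> s k Is; apply: (inC_ge0 _ H); exact: I01E.
  - by move=> s Is; apply: (inC_mass H); exact: I01E.
  - move=> k; apply: continuous_of_integral (id^~ k).
    apply: integrable_dlap => // j; have := w_reparam_integrable 1 H c0 j.
    by rewrite E.
  - by move=> k; have := @w_reparam_measurable _ _ _ _ (-1) 1 H k; rewrite E.
  - by rewrite act.
  - by rewrite /rho' a0 (inC_end H).
  - by rewrite /rho' a1 (inC_start H).
by exists w''; split => //; rewrite Aw.
Qed.

Lemma inC_concat x y z rho1 w1 rho2 w2 (th : R) : 0 < th -> th < 1 ->
  inC delta x y rho1 w1 -> (action delta rho1 w1 < +oo)%E ->
  inC delta y z rho2 w2 -> (action delta rho2 w2 < +oo)%E ->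
  exists rho w, inC delta x z rho w /\
    (action delta rho w = th^-1%:E * action delta rho1 w1 +
                          (1 - th)^-1%:E * action delta rho2 w2)%E.
Proof.
move=> th0 th1 H1 A1 H2 A2.
(* The first path runs on [[0, th]] at speed [c1] and the second on [[th, 1]] at speed [c2]; the
   shift [d2] sends [th] to time 0 of the second. *)
pose c1 := th^-1; pose c2 := (1 - th)^-1; pose d2 := - th / (1 - th).
have th1' : 0 < 1 - th by lra.
have c10 : 0 < c1 by rewrite invr_gt0.
have c20 : 0 < c2 by rewrite invr_gt0.
have c1n : c1 != 0 by rewrite gt_eqF.
have c2n : c2 != 0 by rewrite gt_eqF.
have e10 : affine c1 0 0 = 0 by rewrite /affine mulr0 addr0.
have e11 : affine c1 0 th = 1 by rewrite /affine mulVf ?gt_eqF// addr0.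
have e20 : affine c2 d2 th = 0 by rewrite /affine /c2 /d2; field; rewrite gt_eqF.
have e21 : affine c2 d2 1 = 1 by rewrite /affine /c2 /d2; field; rewrite gt_eqF.
have E1 : affine c1 0 @^-1` I01 = `[0, th]%classic.
  by have := affine_preimage_cc 0 0 th c10; rewrite e10 e11.
have E2 : affine c2 d2 @^-1` I01 = `[th, 1]%classic.
  by have := affine_preimage_cc d2 th 1 c20; rewrite e20 e21.
pose r1 s := rho1 (affine c1 0 s); pose v1 s k := c1 * w1 (affine c1 0 s) k.
pose r2 s := rho2 (affine c2 d2 s); pose v2 s k := c2 * w2 (affine c2 d2 s) k.
pose rho := paste th r1 r2; pose w := paste th v1 v2.
have le0 : 0 <= th by exact: ltW.
have le1 : th <= 1 by exact: ltW.
have rthE : r1 th = r2 th.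
  by rewrite /r1 /r2 e11 e20 (inC_end H1) (inC_start H2).
(* Any expression in the current state of the pasted path is itself a paste, so [integral_paste]
   applies to each integrand below. *)
have pasteE (T : Type) (F : R -> (int -> R) -> (int -> R) -> T) :
    (fun s => F s (w s) (rho s)) =
    paste th (fun s => F s (v1 s) (r1 s)) (fun s => F s (v2 s) (r2 s)).
  by apply/funext => s; rewrite /w /rho /paste; case: ifP.
have rho_prop (P : (int -> R) -> Prop) :
    (forall s, I01 s -> P (rho1 s)) -> (forall s, I01 s -> P (rho2 s)) ->
    forall s, I01 s -> P (rho s).
  move=> h1 h2 s; rewrite /= in_itv/= => /andP[s0 s1]; rewrite /rho /paste.
  case: leP => hs.
    by apply: h1; suff : (affine c1 0 @^-1` I01) s by []; rewrite E1 /= in_itv/= s0 hs.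
  by apply: h2; suff : (affine c2 d2 @^-1` I01) s by []; rewrite E2 /= in_itv/= s1 ltW.
have mw k : measurable_fun I01 (fun s => w s k).
  rewrite (pasteE _ (fun _ f _ => f k)); apply: measurable_fun_paste => //.
  - by have := @w_reparam_measurable _ _ _ _ c1 0 H1 k; rewrite E1.
  - by have := @w_reparam_measurable _ _ _ _ c2 d2 H2 k; rewrite E2.
have iw k : mu.-integrable I01 (fun s => (w s k)%:E).
  have i1 := w_reparam_integrable 0 H1 c1n k; rewrite E1 in i1.
  have i2 := w_reparam_integrable d2 H2 c2n k; rewrite E2 in i2.
  apply/integrableP; split; first by apply/measurable_EFinP; exact: mw.
  rewrite (pasteE _ (fun _ f _ => `|(f k)%:E|)%E) integral_paste//.
  - by rewrite lte_add_pinfty//; [case/integrableP: i1|case/integrableP: i2].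
  - by apply: measurableT_comp => //; exact: (measurable_int _ i1).
  - by apply: measurableT_comp => //; exact: (measurable_int _ i2).
have act : (action delta rho w = th^-1%:E * action delta rho1 w1 +
                          (1 - th)^-1%:E * action delta rho2 w2)%E.
  have Q0 u (r : R -> int -> R) k : (0 <= \int[mu]_(s in I01) Qf (u s k) (r s k))%E.
    by apply: integral_ge0 => s _; exact: Qf_ge0.
  rewrite /action 2!(muleCA _ delta%:E) -ge0_muleDr; last 2 first.
  - by apply: mule_ge0; [rewrite lee_fin ltW|apply: esum_ge0 => k _; exact: Q0].
  - by apply: mule_ge0; [rewrite lee_fin ltW|apply: esum_ge0 => k _; exact: Q0].
  congr (_ * _)%E; rewrite -!esumZl ?(ltW c10) ?(ltW c20)// -esumD; last 2 first.
  - by move=> k _; rewrite mule_ge0// lee_fin ltW.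
  - by move=> k _; rewrite mule_ge0// lee_fin ltW.
  apply: eq_esum => k _.
  have q1 := integral_Qf_reparam 0 H1 c1n k; rewrite E1 gtr0_norm// in q1.
  have q2 := integral_Qf_reparam d2 H2 c2n k; rewrite E2 gtr0_norm// in q2.
  rewrite (pasteE _ (fun _ f g => Qf (f k) (g k))) integral_paste//; first by rewrite q1 q2.
  - apply: measurable_fun_Qf => //.
      by have := @w_reparam_measurable _ _ _ _ c1 0 H1 k; rewrite E1.
    by have := @rho_reparam_measurable _ _ _ _ c1 0 H1 k; rewrite E1.
  - apply: measurable_fun_Qf => //.
      by have := @w_reparam_measurable _ _ _ _ c2 d2 H2 k; rewrite E2.
    by have := @rho_reparam_measurable _ _ _ _ c2 d2 H2 k; rewrite E2.
have id t k : I01 t -> ((rho t k - rho 0 k)%:E =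
    \int[mu]_(s in `[0%R, t]) (dlap delta (w s) k)%:E)%E.
  rewrite /= in_itv/= => /andP[t0 t1].
  have rho0E : rho 0 = r1 0 by rewrite /rho /paste le0.
  have i1 a : 0 <= a -> a <= th -> ((r1 a k - r1 0 k)%:E =
      \int[mu]_(s in `[0%R, a]) (dlap delta (v1 s) k)%:E)%E.
    move=> a0 ath; apply: (reparam_increment H1 c1n) => //.
      by rewrite E1/= in_itv/= lexx.
    by rewrite E1/= in_itv/= a0.
  have [tth|tth] := leP t th.
    rewrite {1}/rho /paste tth rho0E i1//.
    apply: eq_integral => s /set_mem/=; rewrite in_itv/= => /andP[_ st].
    by rewrite /w /paste (le_trans st tth).
  rewrite {1}/rho /paste leNgt tth/= rho0E (pasteE _ (fun _ f _ => (dlap delta f k)%:E)).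
  have g1 : mu.-integrable `[0, th] (fun s => (dlap delta (v1 s) k)%:E).
    apply: integrable_dlap => // j.
    by have := w_reparam_integrable 0 H1 c1n j; rewrite E1.
  have g2 : mu.-integrable `[th, t] (fun s => (dlap delta (v2 s) k)%:E).
    apply: integrable_dlap => // j.
    have := w_reparam_integrable d2 H2 c2n j; rewrite E2; apply: integrableS => //.
    exact: subset_itvl.
  rewrite integral_paste ?(ltW tth)//; [|exact: (measurable_int _ g1)|exact: (measurable_int _ g2)].
  rewrite -i1// -(reparam_increment H2 c2n)//; [|exact: ltW| |].
  - by rewrite -EFinD; congr (_%:E); rewrite -/(r2 t) -/(r2 th) -rthE; ring.
  - by rewrite E2/= in_itv/= lexx.
  - by rewrite E2/= in_itv/= t1 ltW.
exists rho.
have [w'' [Hw Aw]] : exists w'', inC delta x z rho w'' /\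
    action delta rho w'' = action delta rho w.
  apply: inC_of_finite_action => //.
  - move=> s k; move: s; apply: (rho_prop (fun f => 0 <= f k)) => s Is;
      [exact: (inC_ge0 _ H1)|exact: (inC_ge0 _ H2)].
  - apply: (rho_prop (fun f => \esum_(k in [set: int]) (f k)%:E <= delta^-1%:E)%E) => s Is;
      [exact: (inC_mass H1)|exact: (inC_mass H2)].
  - move=> k; apply: continuous_of_integral (id^~ k).
    exact: integrable_dlap.
  - by rewrite act lte_add_pinfty// lte_mul_pinfty// lee_fin ltW.
  - by case: (inC_P2c H1).
  - by rewrite /rho /paste le0 /r1 e10 (inC_start H1).
  - by rewrite /rho /paste leNgt th1 /= /r2 e21 (inC_end H2).
by exists w''; split => //; rewrite Aw.
Qed.

End path_operations.

(** * Minimizing sequences *)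

(* The minimizing sequence is chosen to nearly minimize [G] on shrinking
   sublevel sets of [J], so that the parallelogram inequality for [G] makes it
   a Cauchy sequence. *)
Lemma midpoint_minimizing_sequence (R : realType) (T : Type) (K : set T)
    (J G : T -> R) (d : T -> T -> R) (C : R) :
  K !=set0 -> 0 <= C ->
  (forall p, K p -> 0 <= J p) -> (forall p, K p -> 0 <= G p) ->
  (forall p, K p -> G p <= C * J p) ->
  (forall p q, K p -> K q -> exists m,
    [/\ K m, J m <= Num.max (J p) (J q) & d p q + G m <= (G p + G q) / 2]) ->
  exists (I : R) (u : nat -> T), (forall p, K p -> I <= J p) /\
    (forall n, [/\ K (u n), J (u n) <= I + 2^-1 ^+ n &
                  d (u n) (u n.+1) <= 2 * 4^-1 ^+ n]).
Proof.
move=> [p0 Kp0] C0 J0 G0 GJ mid.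
have lbJ : lbound (J @` K) 0 by move=> _ [p Kp <-]; exact: J0.
have infJ : has_inf (J @` K) by split; [exists (J p0); exists p0|exists 0].
pose I := inf (J @` K).
have IJ p : K p -> I <= J p by move=> Kp; apply: ge_inf; [case: infJ|exists p].
pose e n : R := 2^-1 ^+ n.
have e0 n : 0 < e n by rewrite exprn_gt0.
have e_noninc m n : (m <= n)%N -> e n <= e m.
  by move=> mn; apply: ler_wiXn2l => //; lra.
have f0 n : 0 < (4^-1 : R) ^+ n by rewrite exprn_gt0.
pose L n := [set p | K p /\ J p <= I + e n].
have L_nonempty n : L n !=set0.
  by have [_ [p Kp <-] h] := inf_adherent (e0 n) infJ; exists p; split => //; exact: ltW.
pose g n := inf (G @` L n).
have infG n : has_inf (G @` L n).
  split; first by have [p Lp] := L_nonempty n; exists (G p); exists p.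
  by exists 0 => _ [p [Kp _] <-]; exact: G0.
have gG n p : L n p -> g n <= G p.
  by move=> Lp; apply: ge_inf; [case: (infG n)|exists p].
have g_nondec m n : (m <= n)%N -> g m <= g n.
  move=> mn; apply: lb_le_inf; first by case: (infG n).
  move=> _ [p [Kp Jp] <-]; apply: gG; split => //.
  by apply: le_trans Jp _; rewrite lerD2l e_noninc.
have supg : has_sup (range g).
  split; first by exists (g 0%N); exists 0%N.
  (* Every level set lies in [J <= I + 1], where [G <= C J] is bounded. *)
  exists (C * (I + 1)) => _ [n _ <-].
  have [p Lp] := L_nonempty n; apply: le_trans (gG n p Lp) _.
  case: Lp => Kp Jp; apply: le_trans (GJ p Kp) _; rewrite ler_wpM2l//.
  apply: le_trans Jp _; rewrite lerD2l.
  by apply: le_trans (e_noninc _ _ (leq0n n)) _; rewrite /e expr0.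
pose gs := sup (range g).
have g_le n : g n <= gs by apply: ub_le_sup; [case: supg|exists n].
have /choice[N hN] : forall j, exists n, gs - 4^-1 ^+ j < g n.
  by move=> j; have [_ [n _ <-] h] := sup_adherent (f0 j) supg; exists n.
(* [M] is nondecreasing with [N j <= M j] and [j <= M j]: [g (M j)] is then within [4^-j] of [gs],
   and [J <= I + 2^-j] on [L (M j)]. *)
pose M j := (\sum_(i < j.+1) (N i).+1)%N.
have MN j : (N j <= M j)%N.
  by rewrite /M big_ord_recr/=; apply: leq_trans (leqnSn _) (leq_addl _ _).
have MS j : (M j <= M j.+1)%N by rewrite {2}/M big_ord_recr/= leq_addr.
have Mj j : (j <= M j)%N.
  elim: j => // j ih; rewrite /M big_ord_recr/= -/(M j); lia.
have /choice[u hu] : forall j, exists p, L (M j) p /\ G p < g (M j) + 4^-1 ^+ j.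
  by move=> j; have [_ [p Lp <-] h] := inf_adherent (f0 j) (infG (M j)); exists p.
exists I, u; split => // n.
have [[Kn Jn] Gn] := hu n; have [[Kn1 Jn1] Gn1] := hu n.+1.
split => //; first by apply: le_trans Jn _; rewrite lerD2l e_noninc.
have [m [Km Jm dm]] := mid _ _ Kn Kn1.
have Lm : L (M n) m.
  split => //; apply: le_trans Jm _; rewrite ge_max Jn/=.
  by apply: le_trans Jn1 _; rewrite lerD2l e_noninc.
(* [G] is below [gs + 4^-n] and [gs + 4^-(n+1)] at the two endpoints and above [gs - 4^-n] at the
   midpoint; together this gives [13/8 * 4^-n], within the stated bound. *)
have h1 := gG _ _ Lm; have h2 := hN n; have h3 := g_nondec _ _ (MN n).
have h4 := g_le (M n); have h5 := g_le (M n.+1); have h6 := f0 n.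
have h7 : (4^-1 : R) ^+ n.+1 = 4^-1 * 4^-1 ^+ n by rewrite exprS.
lra.
Qed.

Section midpoint_paths.
Context {R : realType} (delta : R).
Hypothesis delta_gt0 : 0 < delta.
Local Notation mu := (@lebesgue_measure R).
Local Notation I01 := (`[0%R, 1%R]%classic : set R).
Implicit Types (rho w : R -> int -> R) (x y : int -> R).

Definition energy w : \bar R :=
  (\esum_(k in [set: int]) \int[mu]_(s in I01) ((w s k) ^+ 2)%:E)%E.

Lemma energy_ge0 w : (0 <= energy w)%E.
Proof.
apply: esum_ge0 => k _; apply: integral_ge0 => s _; by rewrite lee_fin sqr_ge0.
Qed.

(** One factor [delta^-1] bounds [rho]; the other undoes the factor [delta] in the definition of the
    action. *)
Lemma energy_le_action x y rho w : inC delta x y rho w ->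
  (energy w <= (delta ^- 2)%:E * action delta rho w)%E.
Proof.
move=> H.
have -> : ((delta ^- 2)%:E * action delta rho w =
    \esum_(k in [set: int]) (delta^-1%:E * \int[mu]_(s in I01) Qf (w s k) (rho s k)))%E.
  rewrite esumZl ?invr_ge0 ?ltW//; last first.
    by move=> k _; apply: integral_ge0 => s _; exact: Qf_ge0.
  rewrite /action muleA -EFinM; congr (_%:E * _)%E; field; by rewrite gt_eqF.
apply: le_esum => k _; apply: sqr_integral_le_Qf => //.
- by move=> s Is; rewrite (inC_ge0 _ H)// esum_term_le// (inC_mass delta_gt0 H).
- exact: inC_rho_measurable H.
- exact: inC_w_measurable H.
Qed.

Lemma parallelogram w1 w2 :
  (forall k, measurable_fun I01 (fun s => w1 s k)) ->
  (forall k, measurable_fun I01 (fun s => w2 s k)) ->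
  (energy (fun s k => ((w1 s k - w2 s k) / 2)%R) + energy (fun s k => ((w1 s k + w2 s k) / 2)%R) =
   2^-1%:E * (energy w1 + energy w2))%E.
Proof.
move=> m1 m2.
have m k (f : R -> int -> R) : (forall k, measurable_fun I01 (fun s => f s k)) ->
    measurable_fun I01 (fun s => ((f s k) ^+ 2)%:E).
  by move=> mf; apply/measurable_EFinP; apply: measurable_funX; exact: mf.
have p (f : R -> int -> R) k s : (0 <= ((f s k) ^+ 2)%:E)%E by rewrite lee_fin sqr_ge0.
have ip (f : R -> int -> R) k : (0 <= \int[mu]_(s in I01) ((f s k) ^+ 2)%:E)%E.
  by apply: integral_ge0 => s _; exact: p.
have eD (f g : R -> int -> R) : (energy f + energy g = \esum_(k in [set: int])
    (\int[mu]_(s in I01) ((f s k) ^+ 2)%:E + \int[mu]_(s in I01) ((g s k) ^+ 2)%:E))%E.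
  by apply/esym/esumD => k _; exact: ip.
rewrite !eD -esumZl//; last by move=> k _; rewrite adde_ge0.
apply: eq_esum => k _.
have md : forall k, measurable_fun I01 (fun s => (w1 s k - w2 s k) / 2).
  by move=> j; apply: measurable_funM => //; apply: measurable_funB; [exact: m1|exact: m2].
have ms : forall k, measurable_fun I01 (fun s => (w1 s k + w2 s k) / 2).
  by move=> j; apply: measurable_funM => //; apply: measurable_funD; [exact: m1|exact: m2].
rewrite -ge0_integralD//; [|by move=> s _; rewrite lee_fin sqr_ge0|exact: (m k _ md)|
  by move=> s _; rewrite lee_fin sqr_ge0|exact: (m k _ ms)].
rewrite -ge0_integralD//; [|exact: m|exact: m].
rewrite -ge0_integralZl//; last 2 first.
- by apply: emeasurable_funD; exact: m.
- by move=> s _; rewrite adde_ge0.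
by apply: eq_integral => s _; rewrite -!EFinD -EFinM; congr (_%:E); field.
Qed.

Definition mid (f g : R -> int -> R) (s : R) (k : int) : R := (f s k + g s k) / 2.

Section midpoint.
Variables (x y : int -> R) (rho1 w1 rho2 w2 : R -> int -> R).
Hypotheses (H1 : inC delta x y rho1 w1) (H2 : inC delta x y rho2 w2).
Hypothesis A1 : (action delta rho1 w1 < +oo)%E.
Hypothesis A2 : (action delta rho2 w2 < +oo)%E.

Lemma action_mid_le : (action delta (mid rho1 rho2) (mid w1 w2) <=
  2^-1%:E * (action delta rho1 w1 + action delta rho2 w2))%E.
Proof.
have Q0 u (r : R -> int -> R) k : (0 <= \int[mu]_(s in I01) Qf (u s k) (r s k))%E.
  by apply: integral_ge0 => s _; exact: Qf_ge0.
rewrite /action -ge0_muleDr; [|by apply: esum_ge0 => k _; exact: Q0..].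
rewrite muleCA lee_pmul2l// -esumD//.
rewrite -esumZl//; last by move=> k _; rewrite adde_ge0.
apply: le_esum => k _.
have m1 := inC_Qf_measurable k H1; have m2 := inC_Qf_measurable k H2.
rewrite -ge0_integralD//; [|by move=> s _; exact: Qf_ge0..].
rewrite -ge0_integralZl//; last 2 first.
- exact: emeasurable_funD.
- by move=> s _; rewrite adde_ge0// Qf_ge0.
apply: ge0_le_integral => //.
- by move=> s _; exact: Qf_ge0.
- apply: measurable_fun_Qf => //; apply: measurable_funM => //; apply: measurable_funD.
  + exact: inC_w_measurable H1.
  + exact: inC_w_measurable H2.
  + exact: inC_rho_measurable H1.
  + exact: inC_rho_measurable H2.
- by apply: emeasurable_funM => //; exact: emeasurable_funD.
- by move=> s Is; apply: Qf_midpoint_le; [exact: (inC_ge0 _ H1)|exact: (inC_ge0 _ H2)].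
Qed.

(** Admissibility is shown for the literal midpoint, not for a modification on a null set, so that
    [parallelogram] applies to it as stated. *)
Lemma inC_mid : inC delta x y (mid rho1 rho2) (mid w1 w2).
Proof.
have finA : (action delta (mid rho1 rho2) (mid w1 w2) < +oo)%E.
  by apply: le_lt_trans action_mid_le _; rewrite lte_mul_pinfty// lte_add_pinfty.
have r0 s k : I01 s -> 0 <= mid rho1 rho2 s k.
  by move=> Is; rewrite divr_ge0// addr_ge0// ?(inC_ge0 _ H1)// (inC_ge0 _ H2).
have mass s : I01 s -> (\esum_(k in [set: int]) (mid rho1 rho2 s k)%:E <= delta^-1%:E)%E.
  move=> Is.
  have -> : (\esum_(k in [set: int]) (mid rho1 rho2 s k)%:E = 2^-1%:E *
      (\esum_(k in [set: int]) (rho1 s k)%:E + \esum_(k in [set: int]) (rho2 s k)%:E))%E.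
    rewrite -esumD; [|by move=> k _; rewrite lee_fin (inC_ge0 _ H1)|
      by move=> k _; rewrite lee_fin (inC_ge0 _ H2)].
    rewrite -esumZl//; last first.
      by move=> k _; rewrite adde_ge0// lee_fin ?(inC_ge0 _ H1)// (inC_ge0 _ H2).
    by apply: eq_esum => k _; rewrite /mid -EFinD -EFinM mulrC.
  apply: (@le_trans _ _ (2^-1%:E * (delta^-1%:E + delta^-1%:E))%E).
    by rewrite lee_pmul2l// leeD// ?(inC_mass delta_gt0 H1)// (inC_mass delta_gt0 H2).
  by rewrite -EFinD -EFinM lee_fin; lra.
have mw k : measurable_fun I01 (fun s => mid w1 w2 s k).
  apply: measurable_funM => //; apply: measurable_funD;
    [exact: inC_w_measurable H1|exact: inC_w_measurable H2].
have iw k : mu.-integrable I01 (fun s => (mid w1 w2 s k)%:E).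
  rewrite (_ : (fun s => _) = (fun s => 2^-1%:E * ((w1 s k)%:E + (w2 s k)%:E))%E).
    by apply: integrableZl => //; apply: integrableD => //;
      [exact: inC_w_integrable H1|exact: inC_w_integrable H2].
  by apply/funext => s; rewrite /mid mulrC.
have id t k : I01 t -> ((mid rho1 rho2 t k - mid rho1 rho2 0 k)%:E =
    \int[mu]_(s in `[0%R, t]) (dlap delta (mid w1 w2 s) k)%:E)%E.
  move=> It; have := It; rewrite /= in_itv/= => /andP[t0 t1].
  have tI : `[0%R, t] `<=` I01 by exact: subset_itvl.
  have i1 : mu.-integrable `[0%R, t] (fun s => (dlap delta (w1 s) k)%:E).
    by apply: integrable_dlap => // j; apply: integrableS (inC_w_integrable j H1).
  have i2 : mu.-integrable `[0%R, t] (fun s => (dlap delta (w2 s) k)%:E).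
    by apply: integrable_dlap => // j; apply: integrableS (inC_w_integrable j H2).
  transitivity (\int[mu]_(s in `[0%R, t]) (2^-1%:E *
      ((dlap delta (w1 s) k)%:E + (dlap delta (w2 s) k)%:E)))%E; last first.
    by apply: eq_integral => s _; rewrite -EFinD -EFinM /mid /dlap;
      congr (_%:E); field; rewrite gt_eqF.
  rewrite integralZl//; last exact: integrableD.
  rewrite integralD// -(inC_increment _ H1)// -(inC_increment _ H2)//.
  by rewrite -EFinD -EFinM /mid; congr (_%:E); field.
have cont k : {within I01, continuous (fun s => mid rho1 rho2 s k)}.
  by apply: continuous_of_integral (id^~ k); exact: integrable_dlap.
have start : mid rho1 rho2 0 = x.
  by apply/funext => k; rewrite /mid (inC_start H1) (inC_start H2); lra.
split.
  move=> s Is; apply: (@finite_action_P2c _ _ delta_gt0 _ (mid w1 w2) x) => //.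
  by case: (inC_P2c H1).
split.
  move=> s Is; apply: (@le_lt_trans _ _ (\esum_(k in [set: int])
      (((w1 s k) ^+ 2)%:E + ((w2 s k) ^+ 2)%:E))%E).
    apply: le_esum => k _; rewrite -EFinD lee_fin /mid.
    by have := sqr_ge0 (w1 s k); have := sqr_ge0 (w2 s k); have := sqr_ge0 (w1 s k - w2 s k); nra.
  rewrite esumD; [|by move=> k _; rewrite lee_fin sqr_ge0..].
  by apply: lte_add_pinfty; [case: H1 => _ [h _]|case: H2 => _ [h _]]; exact: h.
split.
  move=> k; split => //; split => //; split; last by move=> t; exact: id.
  exact: (@finite_action_sqr _ _ delta_gt0 (mid rho1 rho2)).
split => //.
by apply/funext => k; rewrite /mid (inC_end H1) (inC_end H2); lra.
Qed.

End midpoint.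

Lemma Dsq_minimizing_sequence x y : (Dsq delta x y < +oo)%E ->
  exists (D : R) (rho w : nat -> R -> int -> R),
  [/\ Dsq delta x y = D%:E,
      forall n, inC delta x y (rho n) (w n),
      forall n, (action delta (rho n) (w n) <= (D + 2^-1 ^+ n)%:E)%E &
      forall n, (energy (fun s k => ((w n s k - w n.+1 s k) / 2)%R)
                  <= (2 * 4^-1 ^+ n)%:E)%E].
Proof.
move=> fin.
pose P := ((R -> int -> R) * (R -> int -> R))%type.
(* Finite action makes [J] and, through [energy_le_action], [G] faithful real values. *)
pose K : set P := [set p | inC delta x y p.1 p.2 /\ (action delta p.1 p.2 < +oo)%E].
pose J (p : P) := fine (action delta p.1 p.2).
pose G (p : P) := fine (energy p.2).
pose d (p q : P) := fine (energy (fun s k => (p.2 s k - q.2 s k) / 2)).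
have A0 (p : P) : (0 <= action delta p.1 p.2)%E.
  apply: mule_ge0; first by rewrite lee_fin ltW.
  by apply: esum_ge0 => k _; apply: integral_ge0 => s _; exact: Qf_ge0.
have JE p : K p -> action delta p.1 p.2 = (J p)%:E.
  by move=> [_ h]; rewrite /J fineK// ge0_fin_numE.
have GE p : K p -> energy p.2 = (G p)%:E.
  move=> Kp; rewrite /G fineK// ge0_fin_numE ?energy_ge0//.
  apply: le_lt_trans (energy_le_action Kp.1) _; rewrite (JE _ Kp) -EFinM ltry//.
have par p q : K p -> K q -> energy (fun s k => (p.2 s k - q.2 s k) / 2) = (d p q)%:E /\
    d p q + G (mid p.1 q.1, mid p.2 q.2) = (G p + G q) / 2.
  move=> Kp Kq.
  have Kr : K (mid p.1 q.1, mid p.2 q.2).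
    split; first exact: inC_mid Kp.1 Kq.1 Kp.2 Kq.2.
    apply: le_lt_trans (action_mid_le Kp.1 Kq.1) _.
    by rewrite lte_mul_pinfty// lte_add_pinfty//; [case: Kp|case: Kq].
  have := @parallelogram p.2 q.2 (fun k => inC_w_measurable k Kp.1)
    (fun k => inC_w_measurable k Kq.1).
  rewrite -[X in (_ + energy X)%E]/(mid p.2 q.2).
  rewrite (GE p Kp) (GE q Kq) (GE _ Kr) -EFinD -EFinM => h.
  have dfin : energy (fun s k => (p.2 s k - q.2 s k) / 2) \is a fin_num.
    rewrite ge0_fin_numE ?energy_ge0//; apply: (@le_lt_trans _ _ (2^-1 * (G p + G q))%:E).
      by rewrite -h leeDl// lee_fin fine_ge0// energy_ge0.
    exact: ltry.
  split; first by rewrite /d fineK.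
  by move: h; rewrite -(fineK dfin) -EFinD => -[]; rewrite -/(d p q); lra.
have Kne : K !=set0.
  have /ereal_inf_lt[_ [rho [w [H ->]] h]] := fin.
  by exists (rho, w).
have [|p _|p _|p Kp|p q Kp Kq|D [u [hD hu]]] :=
  @midpoint_minimizing_sequence R P K J G d (delta ^- 2) Kne.
- by rewrite invr_ge0 sqr_ge0.
- exact: fine_ge0.
- exact/fine_ge0/energy_ge0.
- by rewrite -lee_fin EFinM -GE// -JE//; exact: energy_le_action Kp.1.
- exists (mid p.1 q.1, mid p.2 q.2).
  have Kr : K (mid p.1 q.1, mid p.2 q.2).
    split; first exact: inC_mid Kp.1 Kq.1 Kp.2 Kq.2.
    apply: le_lt_trans (action_mid_le Kp.1 Kq.1) _.
    by rewrite lte_mul_pinfty// lte_add_pinfty//; [case: Kp|case: Kq].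
  split => //; last by have [_ ->] := par _ _ Kp Kq.
  have := action_mid_le Kp.1 Kq.1; rewrite (JE _ Kp) (JE _ Kq).
  have := JE _ Kr => /= ->; rewrite -EFinD -EFinM lee_fin => h.
  by apply: le_trans h _; rewrite le_max;
    case: (leP (J p) (J q)) => ?; apply/orP; [right|left]; lra.
exists D, (fun n => (u n).1), (fun n => (u n).2); split.
(* Admissible paths outside [K] have infinite action and cannot lower the infimum; conversely, the
   actions along the sequence come within any [e] of [D]. *)
- apply/eqP; rewrite eq_le; apply/andP; split; last first.
    apply: le_ereal_inf_tmp => _ [rho [w [H ->]]].
    have [h|] := ltP (action delta rho w) +oo%E; last by rewrite leye_eq => /eqP ->; exact: leey.
    by have Kp : K (rho, w) by []; rewrite (JE _ Kp) lee_fin hD.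
  apply/lee_addgt0Pr => e e0.
  have [n hn] : exists n, (2^-1 : R) ^+ n < e.
    have := @cvg_expr R 2^-1; rewrite ger0_norm// => /(_ _) h.
    have /cvgrPdist_lt/(_ e e0)[n _ hn] : 2^-1 ^+ n @[n --> \oo] --> (0 : R).
      by apply: h; lra.
    exists n; have := hn n (leqnn n); rewrite /= sub0r normrN ger0_norm//.
  have [Kn Jn _] := hu n.
  apply: (@le_trans _ _ (action delta (u n).1 (u n).2)).
    by apply: ereal_inf_lbound; exists (u n).1, (u n).2; split => //; case: Kn.
  by rewrite (JE _ Kn) -EFinD lee_fin; apply: le_trans Jn _; rewrite lerD2l ltW.
- by move=> n; have [[]] := hu n.
- by move=> n; have [Kn Jn _] := hu n; rewrite (JE _ Kn) lee_fin.
- move=> n; have [Kn _ dn] := hu n; have [Kn1 _ _] := hu n.+1.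
  by have [-> _] := par _ _ Kn Kn1; rewrite lee_fin.
Qed.

End midpoint_paths.

(** * Passage to the limit *)

Section fast_cauchy.
Context d (T : measurableType d) (R : realType) (mu : {measure set T -> \bar R}).
Variables (D : set T) (mD : measurable D) (f : nat -> T -> R) (C : R).
Hypothesis mf : forall n, measurable_fun D (f n).
Hypothesis if0 : mu.-integrable D (EFin \o f 0%N).
Hypothesis fast : forall n,
  (\int[mu]_(x in D) `|f n x - f n.+1 x|%:E <= (C * 2^-1 ^+ n)%:E)%E.

(** The function [|f 0|] plus the sum of all increments [|f n - f (n+1)|] dominates every [f n], and
    where it is finite the telescoping series converges absolutely. *)
Lemma L1_fast_cauchy_dominated : exists h : T -> \bar R,
  [/\ mu.-integrable D h, (forall n x, D x -> (`|f n x|%:E <= h x)%E) &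
      forall x, D x -> h x \is a fin_num -> cvgn (fun n => f n x)].
Proof.
pose u n x := `|f n x - f n.+1 x|.
pose h x := (`|f 0%N x|%:E + \sum_(n <oo) (u n x)%:E)%E.
have u0 n x : (0 <= (u n x)%:E)%E by rewrite lee_fin normr_ge0.
have mu_ n : measurable_fun D (fun x => (u n x)%:E).
  apply/measurable_EFinP; apply: measurableT_comp => //.
  by apply: measurable_funB; exact: mf.
have ms : measurable_fun D (fun x => \sum_(n <oo) (u n x)%:E)%E.
  by apply: ge0_emeasurable_sum => // n x _ _; exact: u0.
have m0 : measurable_fun D (fun x => `|f 0%N x|%:E).
  by apply/measurable_EFinP; apply: measurableT_comp => //; exact: mf.
have s0 x : (0 <= \sum_(n <oo) (u n x)%:E)%E by apply: nneseries_ge0.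
have h0 x : (0 <= h x)%E by rewrite adde_ge0// lee_fin.
have partial n x : ((`|f 0%N x| + \sum_(i < n) u i x)%:E <= h x)%E.
  rewrite EFinD leeD2l// -sumEFin -(big_mkord xpredT (fun i => (u i x)%:E)).
  by apply: nneseries_lim_ge.
exists h; split.
- apply/integrableP; split; first exact: emeasurable_funD.
  under eq_integral do rewrite gee0_abs//.
  rewrite ge0_integralD//.
  apply: lte_add_pinfty; first by case/integrableP: if0.
  rewrite integral_nneseries//.
  (* The value of the geometric series [C 2^-n]. *)
  apply: (@le_lt_trans _ _ (2 * C)%:E); last exact: ltry.
  have i0 n : (0 <= \int[mu]_(x in D) (u n x)%:E)%E by apply: integral_ge0.
  apply: lime_le; first by apply: is_cvg_nneseries.
  apply: nearW => n.
  have C0 : 0 <= C.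
    by have := le_trans (i0 0%N) (fast 0); rewrite expr0 mulr1 lee_fin.
  apply: (@le_trans _ _ (\sum_(0 <= i < n) (C * 2^-1 ^+ i)%:E)%E).
    by apply: lee_sum => i _; exact: fast.
  rewrite sumEFin lee_fin.
  have -> : \sum_(0 <= i < n) C * 2^-1 ^+ i = 2 * C - 2 * C * 2^-1 ^+ n.
    elim: n => [|n ih]; first by rewrite big_nil expr0 mulr1 subrr.
    by rewrite big_nat_recr//= ih exprS; field.
  by rewrite gerBl mulr_ge0// ?mulr_ge0// exprn_ge0.
- move=> n x _; apply: le_trans (partial n x); rewrite lee_fin.
  elim: n => [|n ih]; first by rewrite big_ord0 addr0.
  rewrite big_ord_recr/= addrA; apply: le_trans (lerD ih (lexx _)).
  by have := ler_normB (f n x) (f n x - f n.+1 x); rewrite subKr.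
- move=> x _ hx.
  have cs : cvgn (series (fun i => f i x - f i.+1 x)).
    apply: normed_cvg; apply: nondecreasing_is_cvgn.
      by apply: nondecreasing_series => i _ _; exact: normr_ge0.
    exists (fine (h x)) => _ [n _ <-]; rewrite /= seriesEord /=.
    rewrite -lee_fin fineK//; apply: le_trans (partial n x).
    by rewrite lee_fin lerDr.
  rewrite (_ : (fun n => f n x) = (fun n => f 0%N x - series (fun i => f i x - f i.+1 x) n)).
    by apply: is_cvgB => //; exact: is_cvg_cst.
  apply/funext => n; rewrite seriesEord/=; elim: n => [|n ih]; first by rewrite big_ord0 subr0.
  by rewrite big_ord_recr/= opprD addrA -ih; ring.
Qed.

End fast_cauchy.

Lemma measurable_fun_limn_einf d (T : measurableType d) (R : realType) (D : set T)
    (f : (T -> \bar R)^nat) :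
  (forall n, measurable_fun D (f n)) ->
  measurable_fun D (fun x => limn_einf (f^~ x)).
Proof.
move=> mf; rewrite /limn_einf; apply: measurableT_comp => //.
apply: (@measurable_fun_limn_esup _ _ _ D (fun n x => - f n x)%E) => n.
by apply: measurableT_comp => //; exact: mf.
Qed.

Lemma ae_forall_int d (T : measurableType d) (R : realType)
    (mu : {measure set T -> \bar R}) (P : int -> T -> Prop) :
  (forall k, \forall x \ae mu, P k x) -> \forall x \ae mu, forall k, P k x.
Proof.
move=> h; have h' : \forall x \ae mu, forall n, P (int_enum n) x.
  by apply: ae_foralln => n; exact: h.
apply: (@filterS _ _ (ae_filter_ringOfSetsType mu) _ _ _ h') => x hx k.
by have [_ _ /(_ k I)[n _ <-]] := int_enum_bij.
Qed.

Section existence.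
Context {R : realType} (delta : R).
Hypothesis delta_gt0 : 0 < delta.
Local Notation mu := (@lebesgue_measure R).
Local Notation I01 := (`[0%R, 1%R]%classic : set R).

Lemma Dsq_le_action x y (rho w : R -> int -> R) : inC delta x y rho w ->
  (Dsq delta x y <= action delta rho w)%E.
Proof. by move=> H; apply: ereal_inf_lbound; exists rho, w. Qed.

(** * The limit of a minimizing sequence *)

Section limit.
Variables (x y : int -> R) (D : R) (rho w : nat -> R -> int -> R).
Hypothesis H : forall n, inC delta x y (rho n) (w n).
Hypothesis A : forall n, (action delta (rho n) (w n) <= (D + 2^-1 ^+ n)%:E)%E.
Hypothesis E : forall n, (energy (fun s k => ((w n s k - w n.+1 s k) / 2)%R)
                  <= (2 * 4^-1 ^+ n)%:E)%E.

Let Px : P2c delta x. Proof. by case: (inC_P2c (H 0%N)). Qed.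

(** The rate in L^1 is the square root of the rate for squares. The weight [2^n] balances the two
    terms of the inequality below, which contribute [2^-n] and [2 * 2^-n]. *)
Let w_fast n k :
  (\int[mu]_(s in I01) `|w n s k - w n.+1 s k|%:E <= (3 * 2^-1 ^+ n)%:E)%E.
Proof.
pose v s := (w n s k - w n.+1 s k) / 2.
have mv : measurable_fun I01 v.
  apply: measurable_funM => //; apply: measurable_funB; exact: inC_w_measurable (H _).
have mv2 : measurable_fun I01 (fun s => ((v s) ^+ 2)%:E).
  by apply/measurable_EFinP; exact: measurable_funX.
have p0 : 0 < (2 : R) ^+ n by rewrite exprn_gt0.
have Ev : (\int[mu]_(s in I01) ((v s) ^+ 2)%:E <= (2 * 4^-1 ^+ n)%:E)%E.
  apply: le_trans (E n).
  exact: (@term_le_esum _ _ _ (fun k => \int[mu]_(s in I01)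
    (((w n s k - w n.+1 s k) / 2) ^+ 2)%:E)%E).
(* AM-GM: [2 |v| <= 2^-n + 2^n v^2] *)
apply: (@le_trans _ _ (\int[mu]_(s in I01) ((2^-1 ^+ n)%:E + (2 ^+ n)%:E * ((v s) ^+ 2)%:E))%E).
  apply: ge0_le_integral => //.
  - apply/measurable_EFinP; apply: measurableT_comp => //.
    by apply: measurable_funB; exact: inC_w_measurable (H _).
  - by apply: emeasurable_funD => //; exact: emeasurable_funM.
  - move=> s _; rewrite -EFinM -EFinD lee_fin.
    have -> : w n s k - w n.+1 s k = 2 * v s by rewrite /v; field.
    rewrite normrM ger0_norm// -(real_normK (num_real (v s))) exprVn.
    rewrite -subr_ge0 (_ : _ - _ = 2 ^- n * (2 ^+ n * `|v s| - 1) ^+ 2); last first.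
      by field; rewrite gt_eqF.
    by rewrite mulr_ge0 ?sqr_ge0// invr_ge0 ltW.
rewrite ge0_integralD//; last 2 first.
- by move=> s _; rewrite -EFinM lee_fin mulr_ge0 ?sqr_ge0// ltW.
- exact: emeasurable_funM.
rewrite integral_cst// [X in (_ * X)%E]mu_I01 mule1.
rewrite ge0_integralZl//; last by move=> s _; rewrite lee_fin sqr_ge0.
apply: (@le_trans _ _ ((2^-1 ^+ n)%:E + (2 ^+ n)%:E * (2 * 4^-1 ^+ n)%:E)%E).
  by rewrite leeD2l// lee_pmul2l.
rewrite -EFinM -EFinD lee_fin !exprVn.
have -> : (4 : R) ^+ n = 2 ^+ n * 2 ^+ n by rewrite -exprMn; congr (_ ^+ _); ring.
by rewrite le_eqVlt; apply/orP; left; apply/eqP; field; rewrite gt_eqF.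
Qed.

(** An upper limit exists at every time, which gives measurability at once; [fine] assigns an
    arbitrary value on the null set where convergence may fail. *)
Let wlim s k : R := fine (limn_esup (fun n => (w n s k)%:E)).

Let wlim_meas k : measurable_fun I01 (fun s => wlim s k).
Proof.
apply: (@measurableT_comp _ _ _ _ _ _ fine); first exact: fine_measurable.
apply: (@measurable_fun_limn_esup _ _ _ _ (fun n s => (w n s k)%:E)) => n.
by apply/measurable_EFinP; exact: inC_w_measurable (H n).
Qed.

Let dominated k : exists h : R -> \bar R,
  [/\ mu.-integrable I01 h, (forall n s, I01 s -> (`|w n s k|%:E <= h s)%E) &
      forall s, I01 s -> h s \is a fin_num -> cvgn (fun n => w n s k)].
Proof.
apply: (@L1_fast_cauchy_dominated _ _ R mu I01 _ (fun n s => w n s k) 3) => //.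
- by move=> n; exact: inC_w_measurable (H n).
- exact: inC_w_integrable (H _).
Qed.

Let w_cvg : \forall s \ae mu, forall k, I01 s -> w n s k @[n --> \oo] --> wlim s k.
Proof.
apply: ae_forall_int => k; have [h [ih _ hc]] := dominated k.
apply: (@filterS _ _ (ae_filter_ringOfSetsType mu) _ _ _ (integrable_ae _ ih)) => // s hs Is.
have c := hc s Is (hs Is).
have c' : (w n s k)%:E @[n --> \oo] --> (limn (fun n => w n s k))%:E.
  by apply: cvg_EFin => //; exact: nearW.
by rewrite /wlim (cvg_limn_einf_sup c').2.
Qed.

Let dct t k : I01 t -> mu.-integrable `[0%R, t] (fun s => (wlim s k)%:E) /\
  (\int[mu]_(s in `[0%R, t]) w n s k)%R @[n --> \oo] --> (\int[mu]_(s in `[0%R, t]) wlim s k)%R.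
Proof.
move=> It; have := It; rewrite /= in_itv/= => /andP[t0 t1].
have tI : `[0%R, t] `<=` I01 by exact: subset_itvl.
have [h [ih hd _]] := dominated k.
have [||||||iw _ cw] := @dominated_convergence _ _ _ mu `[0%R, t] _
  (fun n s => (w n s k)%:E) (fun s => (wlim s k)%:E) h.
- by [].
- move=> n; apply/measurable_EFinP; apply: measurable_funS (inC_w_measurable k (H n)) => //.
- by apply/measurable_EFinP; apply: measurable_funS (wlim_meas k).
- apply: (@filterS _ _ (ae_filter_ringOfSetsType mu) _ _ _ w_cvg) => s c ts.
  by apply: cvg_EFin; [exact: nearW|exact/c/tI].
- by apply: integrableS ih.
- by apply: aeW => s n ts; exact/hd/tI.
split => //; rewrite /Rintegral; apply: fine_cvg.
by rewrite fineK//; exact: (integrable_fin_num _ iw).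
Qed.

(** Defined by integrating the limit flux, so the continuity equation holds by construction and
    convergence of [rho n] is deduced at every time. *)
Let rholim s k : R := x k + dlap delta (fun j => \int[mu]_(u in `[0%R, s]) wlim u j) k.

Let rho_cvg t k : I01 t -> rho n t k @[n --> \oo] --> rholim t k.
Proof.
move=> It; have := It; rewrite /= in_itv/= => /andP[t0 t1].
have tI : `[0%R, t] `<=` I01 by exact: subset_itvl.
rewrite (_ : (fun n => rho n t k) =
  (fun n => x k + dlap delta (fun j => \int[mu]_(u in `[0%R, t]) w n u j) k)); last first.
  apply/funext => n; apply/eqP; rewrite addrC -subr_eq -{1}(inC_start (H n)); apply/eqP.
  apply: EFin_inj; rewrite (inC_increment _ (H n))// integral_dlap// => j.
  by apply: integrableS (inC_w_integrable j (H n)).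
apply: cvgD; first exact: cvg_cst.
apply: cvgM; last exact: cvg_cst.
by apply: cvgB; [apply: cvgD|apply: cvgMr]; apply: (dct _ It).2.
Qed.

Let rholim_ge0 t k : I01 t -> 0 <= rholim t k.
Proof.
move=> It; have c := @rho_cvg t k It.
rewrite -(cvg_lim _ c)//; apply: limr_ge; first exact: cvgP c.
by apply: nearW => n; exact: (inC_ge0 _ (H n)).
Qed.

(** Finite sums pass to the limit, but mass might escape to infinity, so only an inequality is
    available at this stage. *)
Let rholim_mass t : I01 t -> (\esum_(k in [set: int]) (rholim t k)%:E <= delta^-1%:E)%E.
Proof.
move=> It; apply: esum_le_bound => s us _; rewrite sumEFin lee_fin.
have c : (\sum_(k <- s) rho n t k) @[n --> \oo] --> \sum_(k <- s) rholim t k.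
  elim: s {us} => [|k s ih].
    by rewrite big_nil; under eq_fun do rewrite big_nil; exact: cvg_cst.
  rewrite big_cons; under eq_fun do rewrite big_cons.
  by apply: cvgD ih; exact: rho_cvg.
rewrite -(cvg_lim _ c)//; apply: limr_le; first exact: cvgP c.
apply: nearW => n; rewrite -lee_fin -sumEFin.
by apply: le_trans (inC_mass delta_gt0 (H n) It); exact: sum_le_esum.
Qed.

Let I1 : I01 1. Proof. by rewrite /= in_itv/= lexx ler01. Qed.

Let wlim_integrable k : mu.-integrable I01 (fun s => (wlim s k)%:E).
Proof. by have [] := @dct 1 k I1. Qed.

Let rholim0 : rholim 0 = x.
Proof.
apply/funext => k; rewrite /rholim /dlap set_itv1 !Rintegral_set1.
by rewrite mulr0 !addr0 subrr mul0r addr0.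
Qed.

Let rholim1 : rholim 1 = y.
Proof.
apply/funext => k; have c := @rho_cvg 1 k I1.
rewrite -(cvg_lim _ c)//; apply: lim_near_cst => //.
by apply: nearW => n; rewrite (inC_end (H n)).
Qed.

Let rholim_increment t k : I01 t -> ((rholim t k - rholim 0 k)%:E =
  \int[mu]_(s in `[0%R, t]) (dlap delta (wlim s) k)%:E)%E.
Proof.
move=> It; rewrite rholim0 integral_dlap//; first by rewrite /rholim addrC addKr.
by move=> j; case: (@dct t j It).
Qed.

Let rholim_cont k : {within I01, continuous (fun s => rholim s k)}.
Proof. by apply: continuous_of_integral (rholim_increment^~ k); exact: integrable_dlap. Qed.

Let Q_lsc k : (\int[mu]_(s in I01) Qf (wlim s k) (rholim s k) <=
  limn_einf (fun n => \int[mu]_(s in I01) Qf (w n s k) (rho n s k)))%E.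
Proof.
have mQ n : measurable_fun I01 (fun s => Qf (w n s k) (rho n s k)).
  exact: inC_Qf_measurable (H n).
have Q0 n s : I01 s -> (0 <= Qf (w n s k) (rho n s k))%E by move=> _; exact: Qf_ge0.
have mI : measurable (I01 : set (measurableTypeR R)) by [].
apply: (le_trans _ (fatou mu mI mQ Q0)).
apply: ae_ge0_le_integral => //.
- by move=> s _; exact: Qf_ge0.
- apply: measurable_fun_Qf => //; first exact: wlim_meas.
  by apply: subspace_continuous_measurable_fun => //; exact: rholim_cont.
- by move=> s _; apply: limn_einf_ge0 => n; exact: Qf_ge0.
- exact: measurable_fun_limn_einf.
- apply: (@filterS _ _ (ae_filter_ringOfSetsType mu) _ _ _ w_cvg) => s c Is.
  apply: Qf_le_limn_einf; [|exact: c|exact: rho_cvg].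
  by move=> n; exact: (inC_ge0 _ (H n)).
Qed.

(** For finitely many [k], superadditivity of the lower limit collects the bounds [Q_lsc], and the
    sums stay below [(D + 2^-n) / delta]; the full sum is the supremum of the finite ones. *)
Lemma action_limit_le : (action delta rholim wlim <= D%:E)%E.
Proof.
rewrite /action muleC -lee_pdivlMr// -EFinM.
apply: esum_le_bound => s us _.
apply: (@le_trans _ _ (\sum_(k <- s)
    limn_einf (fun n => \int[mu]_(s in I01) Qf (w n s k) (rho n s k)))%E).
  by apply: lee_sum => k _; exact: Q_lsc.
apply: le_trans (limn_einf_sum_ge _ _) _.
  by move=> k n; apply: integral_ge0 => t _; exact: Qf_ge0.
apply: (@limn_einf_le_cvg _ _ (fun n => ((D + 2^-1 ^+ n) / delta)%:E)).
  apply: cvg_EFin; first exact: nearW.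
  apply: cvgM; last exact: cvg_cst.
  rewrite -[X in _ --> X]addr0; apply: cvgD; first exact: cvg_cst.
  by apply: cvg_expr; rewrite ger0_norm//; lra.
move=> n; rewrite EFinM lee_pdivlMr//.
apply: le_trans (A n); rewrite /action muleC lee_pmul2l//.
exact: (@sum_le_esum _ _ [set: int] (fun k => \int[mu]_(s in I01) Qf (w n s k) (rho n s k))%E).
Qed.

Lemma limit_path : exists rho' w',
  inC delta x y rho' w' /\ (action delta rho' w' <= D%:E)%E.
Proof.
have fin : (action delta rholim wlim < +oo)%E.
  by apply: le_lt_trans action_limit_le _; exact: ltry.
have [w' [Hw Aw]] := inC_of_finite_action delta_gt0 rholim_ge0 rholim_mass rholim_cont
  wlim_meas fin Px rholim_increment rholim0 rholim1.
by exists rholim, w'; rewrite Aw; split => //; exact: action_limit_le.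
Qed.

End limit.

Lemma Dsq_attained x y : (Dsq delta x y < +oo)%E ->
  exists rho w, inC delta x y rho w /\ action delta rho w = Dsq delta x y.
Proof.
move=> /(Dsq_minimizing_sequence delta_gt0)[D [rho [w [DE H A E]]]].
have [rho' [w' [H' A']]] := limit_path H A E.
exists rho', w'; split => //; apply/eqP; rewrite eq_le [X in _ && X]Dsq_le_action// andbT.
by rewrite DE.
Qed.

End existence.

(** * The distance *)

Section distance.
Context {R : realType} (delta : R).
Hypothesis delta_gt0 : 0 < delta.
Local Notation mu := (@lebesgue_measure R).
Local Notation I01 := (`[0%R, 1%R]%classic : set R).
Implicit Types x y z : int -> R.

Lemma Dsq_ge0 x y : (0 <= Dsq delta x y)%E.
Proof.
apply: le_ereal_inf_tmp => _ [rho [w [_ ->]]].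
apply: mule_ge0; first by rewrite lee_fin ltW.
by apply: esum_ge0 => k _; apply: integral_ge0 => s _; exact: Qf_ge0.
Qed.

Lemma Dist_sqr x y : (Dsq delta x y < +oo)%E -> Dsq delta x y = ((Dist delta x y) ^+ 2)%:E.
Proof.
move=> h; rewrite /Dist sqr_sqrtr ?fine_ge0 ?Dsq_ge0// fineK//.
by rewrite ge0_fin_numE ?Dsq_ge0.
Qed.

Lemma Dsq_refl x : P2c delta x -> Dsq delta x x = 0%E.
Proof.
move=> Px; apply/eqP; rewrite eq_le Dsq_ge0 andbT.
have [x0 _] := Px.
pose w (s : R) (k : int) : R := 0.
have act : action delta (fun=> x) w = 0%E.
  rewrite /action esum1 ?mule0// => k _.
  by rewrite integral0_eq// => s _; exact: Qf0.
rewrite -act; apply: Dsq_le_action; split => //; split.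
  by move=> s _; rewrite esum1 ?ltry// => k _; rewrite /w expr0n.
split => // k; split; first by move=> s; exact: cvg_cst.
split; first exact: measurable_cst.
split; first by rewrite integral0_eq ?ltry// => s _; rewrite /w expr0n.
move=> t _; rewrite subrr integral0_eq// => s _.
by rewrite /dlap /w mulr0 !addr0 subrr mul0r.
Qed.

(** With finiteness assumed on one side only, the inequality also transfers finiteness to the
    exchanged endpoints. *)
Lemma Dsq_sym x y : (Dsq delta x y < +oo)%E -> (Dsq delta y x <= Dsq delta x y)%E.
Proof.
move=> h; have [rho [w [H A]]] := Dsq_attained delta_gt0 h.
have [|rho' [w' [H' A']]] := inC_reverse delta_gt0 H; first by rewrite A.
by rewrite -A -A'; exact: Dsq_le_action.
Qed.

Lemma Dsq_concat x y z (th : R) : 0 < th -> th < 1 ->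
  (Dsq delta x y < +oo)%E -> (Dsq delta y z < +oo)%E ->
  (Dsq delta x z <= th^-1%:E * Dsq delta x y + (1 - th)^-1%:E * Dsq delta y z)%E.
Proof.
move=> th0 th1 h1 h2.
have [rho1 [w1 [H1 A1]]] := Dsq_attained delta_gt0 h1.
have [rho2 [w2 [H2 A2]]] := Dsq_attained delta_gt0 h2.
have f1 : (action delta rho1 w1 < +oo)%E by rewrite A1.
have f2 : (action delta rho2 w2 < +oo)%E by rewrite A2.
have [rho [w [H A]]] := inC_concat delta_gt0 th0 th1 H1 f1 H2 f2.
by rewrite -A1 -A2 -A; exact: Dsq_le_action.
Qed.

Lemma Dsq_trans_lt_pinfty x y z :
  (Dsq delta x y < +oo)%E -> (Dsq delta y z < +oo)%E -> (Dsq delta x z < +oo)%E.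
Proof.
move=> h1 h2; apply: (le_lt_trans (@Dsq_concat x y z 2^-1 _ _ h1 h2)); [lra|lra|].
by apply: lte_add_pinfty; apply: lte_mul_pinfty => //; rewrite lee_fin invr_ge0; lra.
Qed.

Lemma Dsq_eq0 x y : Dsq delta x y = 0%E -> x = y.
Proof.
move=> D0; have fin : (Dsq delta x y < +oo)%E by rewrite D0 ltry.
have [rho [w [H A]]] := Dsq_attained delta_gt0 fin.
have wint0 k : (\int[mu]_(s in I01) ((w s k) ^+ 2)%:E = 0)%E.
  apply/eqP; rewrite eq_le integral_ge0 ?andbT; last by move=> s _; rewrite lee_fin sqr_ge0.
  apply: (@le_trans _ _ (energy w)).
    exact: (@term_le_esum _ _ _ (fun k => \int[mu]_(s in I01) ((w s k) ^+ 2)%:E)%E).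
  by apply: le_trans (energy_le_action delta_gt0 H) _; rewrite A D0 mule0.
have wae : \forall s \ae mu, forall k, I01 s -> w s k = 0.
  apply: ae_forall_int => k.
  have mw2 : measurable_fun I01 (fun s => ((w s k) ^+ 2)%:E).
    by apply/measurable_EFinP; apply: measurable_funX; exact: inC_w_measurable H.
  have /(ae_eq_integral_abs mu _ mw2).1 : (\int[mu]_(s in I01) `|((w s k) ^+ 2)%:E| = 0)%E.
    by rewrite -[RHS](wint0 k); apply: eq_integral => s _; rewrite gee0_abs// lee_fin sqr_ge0.
  move=> /(_ _) ae0.
  apply: (@filterS _ _ (ae_filter_ringOfSetsType mu) _ _ _ (ae0 _)) => // s hs Is.
  by have [/eqP] := hs Is; rewrite sqrf_eq0 => /eqP.
apply/funext => k; rewrite -(inC_start H) -(inC_end H).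
have : ((rho 1 k - rho 0 k)%:E = 0)%E.
  rewrite (inC_increment _ H)//.
  have iw j := inC_w_integrable j H.
  have -> : (0 = \int[mu]_(s in I01) (cst 0 s))%E by rewrite integral0.
  apply: ae_eq_integral => //; first exact: (measurable_int _ (integrable_dlap delta k _ iw)).
  apply: (@filterS _ _ (ae_filter_ringOfSetsType mu) _ _ _ wae) => s h Is.
  by rewrite /dlap !h// mulr0 !addr0 subrr mul0r.
by move=> [/eqP]; rewrite subr_eq0 => /eqP.
Qed.

Lemma Dist_triangle x y z :
  (Dsq delta x y < +oo)%E -> (Dsq delta y z < +oo)%E ->
  Dist delta x z <= Dist delta x y + Dist delta y z.
Proof.
move=> h1 h2; have h3 := Dsq_trans_lt_pinfty h1 h2.
have e1 := Dist_sqr h1; have e2 := Dist_sqr h2; have e3 := Dist_sqr h3.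
have a0 : 0 <= Dist delta x y by exact: sqrtr_ge0.
have b0 : 0 <= Dist delta y z by exact: sqrtr_ge0.
(* Concatenation needs a time strictly between 0 and 1, so vanishing distances are settled first, by
   definiteness. *)
have [a1|a1] := eqVneq (Dist delta x y) 0.
  have xy : x = y by apply: Dsq_eq0; rewrite e1 a1 expr0n.
  by rewrite a1 add0r xy.
have [b1|b1] := eqVneq (Dist delta y z) 0.
  have yz : y = z by apply: Dsq_eq0; rewrite e2 b1 expr0n.
  by rewrite b1 addr0 yz.
set a := Dist delta x y in e1 a0 a1 *; set b := Dist delta y z in e2 b0 b1 *.
have ap : 0 < a by rewrite lt_neqAle eq_sym a1.
have bp : 0 < b by rewrite lt_neqAle eq_sym b1.
(* [th = a / (a + b)] minimizes [a^2 / th + b^2 / (1 - th)] *)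
have := @Dsq_concat x y z (a / (a + b)) _ _ h1 h2.
rewrite e1 e2 e3 -!EFinM -EFinD lee_fin => h.
rewrite -ler_sqr ?nnegrE ?addr_ge0 ?sqrtr_ge0//.
have -> : (a + b) ^+ 2 = (a / (a + b))^-1 * a ^+ 2 + (1 - a / (a + b))^-1 * b ^+ 2.
  by field; rewrite ?(addrC a b) ?addrK !gt_eqF ?addr_gt0.
by apply: h; [rewrite divr_gt0 ?addr_gt0|rewrite ltr_pdivrMr ?addr_gt0// mul1r ltrDl].
Qed.

End distance.

Theorem theorem1p2 (R : realType) (delta : R) (hdelta : 0 < delta)
    (rhos : int -> R) (hrhos : P2c delta rhos) :
  let A := fun rho : int -> R => P2c delta rho /\ (Dsq delta rho rhos < +oo)%E in
  (forall x y, A x -> A y -> (Dsq delta x y < +oo)%E) /\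
  (forall x y, A x -> A y -> (Dist delta x y = 0 <-> x = y)) /\
  (forall x y, A x -> A y -> Dist delta x y = Dist delta y x) /\
  (forall x y z, A x -> A y -> A z ->
     Dist delta x z <= Dist delta x y + Dist delta y z) /\
  (forall x y, A x -> A y ->
     exists (rho w : R -> int -> R),
       inC delta x y rho w /\ action delta rho w = Dsq delta x y).
Proof.
move=> A.
have fin x y : A x -> A y -> (Dsq delta x y < +oo)%E.
  move=> [_ hx] [_ hy]; apply: (Dsq_trans_lt_pinfty hdelta hx).
  exact: le_lt_trans (Dsq_sym hdelta hy) hy.
split; first exact: fin.
split.
  move=> x y Ax Ay; split => [d0|<-].
    by apply: (Dsq_eq0 hdelta); rewrite (Dist_sqr hdelta (fin _ _ Ax Ay)) d0 expr0n.
  by rewrite /Dist (Dsq_refl hdelta Ax.1) sqrtr0.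
split.
  move=> x y Ax Ay; congr (Num.sqrt (fine _)); apply/eqP.
  by rewrite eq_le !(Dsq_sym hdelta)// fin.
split; first by move=> x y z Ax Ay Az; apply: (Dist_triangle hdelta); exact: fin.
by move=> x y Ax Ay; apply: (Dsq_attained hdelta); exact: fin.
Qed.
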